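(* Let $A$ be a finite set with $n$ elements and let $\theta:\mathcal E\to\mathbb R$ be an integrable weight on the set $\mathcal E=\mathcal E_A$ of undirected edges of $A$, with corresponding symmetric matrix $Q$ and $G=(I-Q)^{-1}$. Let $\mu=\mu_{1/2}$ be the (signed) measure on currents $\bar k$ induced by the loop soup of $\theta$ at time $1/2$, and, given $\bar k$, let $\bar T=(T_x)_{x\in A}$ have independent components, $T_x$ having the Gamma distribution with parameters $n_x(\bar k)+\frac12$ and $1$. Then the marginal density of $\bar T$, i.e. the function $$\hat g(\bar t)=\sum_{\bar k\in\mathcal C}\mu(\bar k)\prod_{x\in A}\frac{t_x^{\,n_x(\bar k)-\frac12}}{\Gamma(n_x(\bar k)+\frac12)}\,e^{-t_x},\qquad \bar t\in(0,\infty)^A,$$ is the same as the density of $\{Z_x^2/2:x\in A\}$, where $\bar Z=\{Z_x: x\in A\}$ is the centered multivariate normal random vector indexed by $A$ with covariance matrix $G$.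
   Context: $\mathbb N=\{0,1,2,\dots\}$. $\mathcal E=\mathcal E_A$ is the set of all unordered pairs $\{x,y\}$ of elements of $A$, including self-edges ($x=y$). A real signed weight $\theta$ on $\mathcal E$ corresponds to the symmetric weight $q$ on directed edges $A\times A$ given by $q(x,y)=\theta_{xy}/2$ if $x\ne y$ and $q(x,x)=\theta_{xx}$; $Q=[q(x,y)]_{x,y\in A}$. The weight $\theta$ is integrable if the matrix $[|q(x,y)|]$ has spectral radius strictly less than $1$ (then $G=(I-Q)^{-1}$ is positive definite). For $\bar k\in\mathbb N^{\mathcal E}$, $n_x(\bar k)=\frac12\sum_{e}k_e\,n_e(x)$, where $n_e(x)=2$ if $e$ is a self-edge at $x$, $1$ if $e$ joins $x$ to a different vertex, $0$ otherwise. $\mathcal C$ is the set of (undirected) currents: those $\bar k$ for which every $n_x(\bar k)$ is an integer. Loops: a nontrivial rooted loop is $l=[l_0,\dots,l_n]$ in $A$ with $n\ge1$, $l_n=l_0$; $|l|=n$, $q(l)=\prod_{j=1}^n q(l_{j-1},l_j)$. An unrooted loop $\ell$ is an equivalence class of nontrivial rooted loops under cyclic shift of the root; $s_\ell$ is the number of its distinct representatives. $\mathcal L(A)$ is the set of unrooted loops and $m(\ell)=s_\ell\,q(\ell)/|\ell|$ is the unrooted loop measure. The soup at time $t$ is the (signed) measure $\nu_t[\overline N]=e^{-t\,m(\mathcal L(A))}\prod_{\ell}\frac{(t\,m(\ell))^{N(\ell)}}{N(\ell)!}$ on finite multisets $\overline N:\mathcal L(A)\to\mathbb N$ (for nonnegative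 $\theta$: independent Poisson processes with rates $m(\ell)$ at time $t$). The measure $\mu_t$ on $\mathcal C$ is the image of $\nu_t$ under the map sending a multiset of loops to $\bar k$, $k_e$ being the total number of traversals of $e$ in either direction by all loops counted with multiplicity. The Gamma distribution with parameters $a$ and $1$ has density $t^{a-1}e^{-t}/\Gamma(a)$ on $(0,\infty)$. *)

(* Defs.v *)
From HB Require Import structures.
From mathcomp Require Import all_boot all_order all_algebra.
From mathcomp Require Import finmap multiset.
From mathcomp Require Import complex.
From mathcomp Require Import all_classical all_reals all_analysis.
Set Implicit Arguments.
Unset Strict Implicit.
Unset Printing Implicit Defensive.
Import Order.TTheory GRing.Theory Num.Theory.
Import numFieldNormedType.Exports.
Local Open Scope classical_set_scope.
Local Open Scope ring_scope.

(* The sum of an absolutely summable real family; the value is meaningless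
   unless [summable D (EFin \o f)]. *)
Definition signed_sum (R : realType) (T : choiceType) (D : set T) (f : T -> R)
    : R :=
  fine (\esum_(i in D) (EFin \o f)^\+ i - \esum_(i in D) (EFin \o f)^\- i)%E.

Section Edges.
Variable A : finType.

(* An unordered pair {x, y}, x = y allowed, is a set with one or two elements. *)
Record edge : Type := Edge {
  edge_set :> {set A};
  edge_setP : (0 < #|edge_set| <= 2)%N }.
HB.instance Definition _ := [isSub for edge_set].
HB.instance Definition _ := [Finite of edge by <:].

Fact edge_of_subproof (x y : A) : (0 < #|[set x; y]%SET| <= 2)%N.
Proof. by rewrite cards2; case: (x != y). Qed.

Definition edge_of (x y : A) : edge := Edge (edge_of_subproof x y).

Definition edge_ends (e : edge) (x : A) : nat :=
  (if x \notin edge_set e then 0 else if #|edge_set e| == 1 then 2 else 1)%N.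

End Edges.

Section Weights.
Variables (R : realType) (A : finType) (theta : edge A -> R).

Definition dweight (x y : A) : R :=
  if x == y then theta (edge_of x x) else theta (edge_of x y) / 2.

(* Matrices over A (and tuples, below) are indexed by 'I_#|A| through enum_val. *)
Definition wmatrix : 'M[R]_#|A| :=
  \matrix_(i, j) dweight (enum_val i) (enum_val j).

Definition green : 'M[R]_#|A| := invmx (1%:M - wmatrix).

End Weights.

Definition spectral_radius (R : realType) (n : nat) (M : 'M[R]_n) : R :=
  sup [set Normc.normc z | z in
        [set z : R[i] | eigenvalue (map_mx (real_complex R) M) z]].

Definition integrable_weight (R : realType) (A : finType)
    (theta : edge A -> R) : Prop :=
  spectral_radius (map_mx Num.norm (wmatrix theta)) < 1.

Definition nvisits (R : realType) (A : finType) (k : {ffun edge A -> nat})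
    (x : A) : R :=
  (\sum_e k e * edge_ends e x)%N%:R / 2.

Definition currents (R : realType) (A : finType) : set {ffun edge A -> nat} :=
  [set k | forall x, nvisits R k x \is a Num.int].
Arguments currents : clear implicits.

Section Loops.
Variable A : finType.

(* The rooted loop [l_0, ..., l_n] with n >= 1 and l_n = l_0 is stored as the
   nonempty sequence l_0, ..., l_(n-1), read cyclically (as for [cycle] in
   path.v); its length |l| = n is then the size of that sequence, and moving
   the root is [rot]. *)
Record rooted_loop : Type := RootedLoop {
  rooted_seq :> seq A;
  rooted_seqP : rooted_seq != [::] }.
HB.instance Definition _ := [isSub for rooted_seq].
HB.instance Definition _ := [Countable of rooted_loop by <:].

Definition shifts (s : seq A) : seq (seq A) :=
  [seq rot i s | i <- iota 0 (size s)].

Definition loop_equiv (l l' : rooted_loop) : bool := val l' \in shifts (val l).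

Lemma mem_shifts (s t : seq A) :
  s != [::] -> reflect (exists i, t = rot i s) (t \in shifts s).
Proof.
move=> s0; apply: (iffP mapP) => [[i _ ->]|[i ->]]; first by exists i.
have [ilt|ige] := ltnP i (size s); first by exists i; rewrite ?mem_iota.
by exists 0; rewrite ?rot0 ?rot_oversize// mem_iota/= add0n lt0n size_eq0.
Qed.

Lemma loop_equivP (l l' : rooted_loop) :
  reflect (exists i, val l' = rot i (val l)) (loop_equiv l l').
Proof. exact/mem_shifts/(valP l). Qed.

Fact loop_equiv_refl : reflexive loop_equiv.
Proof. by move=> l; apply/loop_equivP; exists 0; rewrite rot0. Qed.

Fact loop_equiv_sym : symmetric loop_equiv.
Proof.
suff imp l l' : loop_equiv l l' -> loop_equiv l' l.
  by move=> l l'; apply/idP/idP; exact: imp.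
move=> /loop_equivP[i il']; apply/loop_equivP.
by exists (size (val l') - i)%N; rewrite il'; exact/esym/rotK.
Qed.

Fact loop_equiv_trans : transitive loop_equiv.
Proof.
move=> l2 l1 l3 /loop_equivP[i il2] /loop_equivP[j jl3]; apply/loop_equivP.
wlog ilt : i il2 / (i <= size (val l1))%N.
  move=> wl; have [|ige] := leqP i (size (val l1)); first exact: wl.
  by apply: (wl 0); rewrite ?rot0// il2 rot_oversize// ltnW.
wlog jlt : j jl3 / (j <= size (val l1))%N.
  move=> wl; have [|ige] := leqP j (size (val l1)); first exact: wl.
  by apply: (wl 0); rewrite ?rot0// jl3 rot_oversize// il2 size_rot ltnW.
by rewrite jl3 il2 rot_add_mod//; eexists.
Qed.

Canonical loop_equivalence :=
  EquivRel loop_equiv loop_equiv_refl loop_equiv_sym loop_equiv_trans.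

Definition loop : Type := {eq_quot loop_equiv}%qT.
HB.instance Definition _ := EqQuotient.on loop.
HB.instance Definition _ := Choice.on loop.

End Loops.

(* Everything computed below from the representative [repr l] is invariant
   under [rot], hence depends only on the unrooted loop l. *)
Section LoopMeasure.
Variables (R : realType) (A : finType).
Local Open Scope quotient_scope.

Definition loop_seq (l : loop A) : seq A := val (repr l).

(* The pairs (l_(j-1), l_j), 1 <= j <= n, including the closing step. *)
Definition steps (s : seq A) : seq (A * A) := zip s (rot 1 s).

(* [undup]: a loop run through several times has fewer than |l| distinct
   rooted representatives. *)
Definition nrepr (l : loop A) : nat := size (undup (shifts (loop_seq l))).

Definition traversals (l : loop A) (e : edge A) : nat :=
  count (fun p => edge_of p.1 p.2 == e) (steps (loop_seq l)).

Variable theta : edge A -> R.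

Definition loop_weight (l : loop A) : R :=
  \prod_(p <- steps (loop_seq l)) dweight theta p.1 p.2.

Definition loop_measure (l : loop A) : R :=
  (nrepr l)%:R * loop_weight l / (size (loop_seq l))%:R.

Definition total_loop_measure : R :=
  signed_sum [set: loop A] loop_measure.

Definition soup (t : R) (N : multiset (loop A)) : R :=
  expR (- (t * total_loop_measure)) *
  \prod_(l <- finsupp N) ((t * loop_measure l) ^+ N l / (N l)`!%:R).

Definition soup_current (N : multiset (loop A)) : {ffun edge A -> nat} :=
  [ffun e => \sum_(l <- finsupp N) N l * traversals l e]%N.

Definition current_measure (t : R) (k : {ffun edge A -> nat}) : R :=
  signed_sum [set N | soup_current N = k] (soup t).

End LoopMeasure.

Section Gamma.
Variable R : realType.

Definition Gamma (a : R) : R :=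
  \int[lebesgue_measure]_(t in `]0, +oo[%classic) (t `^ (a - 1) * expR (- t)).

Definition gamma_pdf (a t : R) : R := t `^ (a - 1) * expR (- t) / Gamma a.

End Gamma.

Definition ghat_term (R : realType) (A : finType) (theta : edge A -> R)
    (t : A -> R) (k : {ffun edge A -> nat}) : R :=
  current_measure theta (2^-1) k *
  \prod_x gamma_pdf (nvisits R k x + 2^-1) (t x).

Definition ghat (R : realType) (A : finType) (theta : edge A -> R)
    (t : A -> R) : R :=
  signed_sum (currents R A) (ghat_term theta t).

Section LebesgueTuple.
Variable R : realType.

Definition tcons n (p : measurableTypeR R * n.-tuple R) : n.+1.-tuple R :=
  [tuple of (p.1 : R) :: p.2].

Lemma measurable_tcons n : measurable_fun setT (@tcons n).
Proof.
exact: (@measurable_cons _ _ _ R (fst : measurableTypeR R * n.-tuple R -> R)).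
Qed.

Section step.
Variables (n : nat) (mu : {sigma_finite_measure set (n.-tuple R) -> \bar R}).

Definition lebesgue_tuple_step : set (n.+1.-tuple R) -> \bar R :=
  pushforward (@lebesgue_measure R \x mu)%E (@tcons n).

Let step0 : lebesgue_tuple_step set0 = 0%E.
Proof. by rewrite /lebesgue_tuple_step /pushforward preimage_set0 measure0. Qed.

Let step_ge0 B : (0 <= lebesgue_tuple_step B)%E.
Proof. by rewrite /lebesgue_tuple_step /pushforward measure_ge0. Qed.

Let step_sigma_additive : semi_sigma_additive lebesgue_tuple_step.
Proof.
have mpre B : measurable B -> measurable (@tcons n @^-1` B).
  by move=> mB; rewrite -[X in measurable X]setTI; exact: measurable_tcons.
move=> F mF tF mUF; rewrite /lebesgue_tuple_step /pushforward preimage_bigcup.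
apply: measure_semi_sigma_additive.
- by move=> i; exact: mpre.
- apply/trivIsetP => i j _ _ ij; rewrite -preimage_setI.
  by move/trivIsetP : tF => /(_ _ _ _ _ ij) ->//; rewrite preimage_set0.
- by rewrite -preimage_bigcup; exact: mpre.
Qed.

HB.instance Definition _ := isMeasure.Build _ _ _
  lebesgue_tuple_step step0 step_ge0 step_sigma_additive.

Let sigma_finite_step : sigma_finite setT lebesgue_tuple_step.
Proof.
have /sigma_finiteP[F [TF ndF Foo]] := sigma_finiteT (@lebesgue_measure R).
have /sigma_finiteP[G [TG ndG Goo]] := sigma_finiteT mu.
pose h (t : n.+1.-tuple R) : measurableTypeR R * n.-tuple R :=
  (thead t, [tuple of behead t]).
have mh : measurable_fun setT h.
  apply/measurable_fun_pairP; split; first exact: (measurable_tnth ord0).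
  exact: measurable_behead.
have hK p : h (tcons p) = p.
  case: p => x t; rewrite /h /tcons theadE; congr (_, _).
  exact/val_inj.
exists (fun i => h @^-1` (F i `*` G i)).
  rewrite -preimage_bigcup; apply/seteqP; split=> // t _.
  have [i _ Fi] : (\bigcup_i F i) (h t).1 by rewrite -TF.
  have [j _ Gj] : (\bigcup_i G i) (h t).2 by rewrite -TG.
  exists (maxn i j) => //; split.
    by move: Fi; apply/subsetPset/ndF/leq_maxl.
  by move: Gj; apply/subsetPset/ndG/leq_maxr.
move=> i; have [mF Foo'] := Foo i; have [mG Goo'] := Goo i.
have mFG : measurable (F i `*` G i) by exact: measurableX.
split; first by rewrite -[X in measurable X]setTI; exact: mh.
rewrite /lebesgue_tuple_step /pushforward.
have -> : @tcons n @^-1` (h @^-1` (F i `*` G i)) = F i `*` G i.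
  by apply/funext => p; rewrite /preimage /mkset hK.
by rewrite product_measure1E// lte_mul_pinfty// ge0_fin_numE.
Qed.

HB.instance Definition _ := Measure_isSigmaFinite.Build _ _ _
  lebesgue_tuple_step sigma_finite_step.

End step.

Fixpoint lebesgue_tuple n : {sigma_finite_measure set (n.-tuple R) -> \bar R} :=
  if n is m.+1 then lebesgue_tuple_step (lebesgue_tuple m)
  else \d_[tuple].

End LebesgueTuple.

(* A point of R^A is a function A -> R; measurability and integration go through
   #|A|.-tuple R along enum_val and enum_rank. *)
Section Densities.
Variables (R : realType) (A : finType).

Definition to_tuple (f : A -> R) : #|A|.-tuple R :=
  [tuple f (enum_val i) | i < #|A|].

Definition of_tuple (t : #|A|.-tuple R) (x : A) : R := tnth t (enum_rank x).

Definition orthant : set (A -> R) := [set t | forall x, 0 < t x].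

(* f, regarded as a function on D extended by 0, is a density of the joint law
   of (X x)_x. *)
Definition has_density d (T : measurableType d) (P : probability T R)
    (X : A -> T -> R) (D : set (A -> R)) (f : (A -> R) -> R) : Prop :=
  [/\ measurable_fun (of_tuple @^-1` D) (f \o of_tuple),
      forall t, D t -> 0 <= f t &
      forall B, measurable B ->
        P ((fun w => to_tuple (X ^~ w)) @^-1` B) =
        (\int[lebesgue_tuple R #|A|]_(t in B `&` of_tuple @^-1` D)
           (f (of_tuple t))%:E)%E].

(* Density of the centered normal law with nondegenerate covariance G. *)
Definition mvnormal_pdf (G : 'M[R]_#|A|) (z : A -> R) : R :=
  let v : 'rV[R]_#|A| := \row_i z (enum_val i) in
  (Num.sqrt ((2 * pi) ^+ #|A| * \det G))^-1 *
  expR (- ((v *m invmx G *m v^T) 0 0 / 2)).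

Definition centered_normal d (T : measurableType d) (P : probability T R)
    (Z : A -> {RV P >-> R}) (G : 'M[R]_#|A|) : Prop :=
  has_density P (fun x w => Z x w) setT (mvnormal_pdf G).

End Densities.
Arguments orthant : clear implicits.

(* Main.v *)
Require Import Defs.
From HB Require Import structures.
From mathcomp Require Import all_boot all_order all_algebra.
From mathcomp Require Import finmap multiset.
From mathcomp Require Import complex ring lra zify.
From mathcomp Require Import all_classical all_reals all_analysis.
From mathcomp Require Import measurable_realfun.
Set Implicit Arguments.
Unset Strict Implicit.
Unset Printing Implicit Defensive.
Import Order.TTheory GRing.Theory Num.Theory.
Import numFieldNormedType.Exports.
Local Open Scope classical_set_scope.
Local Open Scope ring_scope.

(* Write the density of (Z_x^2/2) as a sum of the density of Z over the sign
   choices z_x = +-sqrt(2 t_x).  Expanding exp(sum_e (theta_e/2) z^e) in powers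
   of theta, the average over signs kills every monomial whose exponent k is not
   a current, so the density is det(I-Q)^(1/2) times a power series indexed by
   currents.  It matches ghat term by term once
     mu(k) = det(I-Q)^(1/2) prod_e (theta_e/2)^(k_e)/k_e! prod_x E[N^(2 n_x(k))],
   N standard normal, because Gamma(n+1/2) = Gamma(1/2) E[N^(2n)]/2^n.
   Let W(k) be the product on the right.  Singling out one loop of the soup shows
   that c(k) = mu(k) exp(m(L(A))/2) satisfies
     |k| c(k) = 1/2 sum_r q(r) c(k - r),
   r ranging over the rooted loops contained in k.  Gaussian integration by parts
   expands the two-point moment of W along paths, and closing these paths up gives
   the same recursion for W; hence c = W.
   Finally m(L(A)) = sum_n tr(Q^n)/n = - log det(I-Q), computed on the spectrum of
   the symmetric matrix Q, with absolute convergence governed by |Q|. *)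

(** * Spectrum of the weight matrix *)

(** The identity mu(k) = det(I-Q)^(1/2) W(k) is proved coefficient by coefficient, not as an
    identity of functions of theta: for each k both c(k) and W(k) are finite expressions. The
    recursion fixes a family from its value 1 at k = 0, because every removed loop has at least one
    step. Why the recursions agree. On the soup side, sum_l N(l)|l| = |k|; the factor N(l) turns the
    weight of N into m(l)/2 times the weight of N minus one copy of l; and |l| m(l) = s_l q(l) gives
    each rooted representative of l the weight q(l). On the Gaussian side |k| is half the number of
    edge ends, which is the 1/2 of the recursion. Deleting an edge between x and w leaves the
    two-point moment at (w, x); its paths from w to x are closed by the deleted edge into loops
    rooted at x. Convergence of series enters twice: for the total loop mass, where integrability is
    used, and for the sum over currents, which is dominated by an exponential series. *)

Section spectrum.
Variable R : realType.

(** Over [R[i]] the matrix is hermitian, so it is unitarily diagonalizable with real diagonal; trace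
    and determinant are read off the diagonal form and descend to [R] by injectivity of the
    embedding. The eigenvalues are stated for the complexified matrix, as in [spectral_radius]. *)
Lemma symmetric_spectrum n (M : 'M[R]_n) : M^T = M ->
  exists lam : 'I_n -> R,
  [/\ forall i, eigenvalue (map_mx (real_complex R) M) (real_complex R (lam i)),
      forall k, \tr (M ^+ k) = \sum_i lam i ^+ k &
      \det (1%:M - M) = \prod_i (1 - lam i)].
Proof.
move=> Msym; pose A := map_mx (real_complex R) M.
have realC (x : R) : real_complex R x \is Num.real.
  by rewrite realE !lecE/= eqxx/= le_total.
have Aherm : A \is hermsymmx.
  apply/is_hermitianmxP; rewrite expr0 scale1r.
  by apply/matrixP => i j; rewrite !mxE -[in LHS]Msym mxE; apply/esym/CrealP.
have := orthomx_spectralP (hermitian_normalmx Aherm).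
have Dreal := hermitian_spectral_diag_real Aherm.
have Pu := spectral_unit A.
move: (spectralmx A) (spectral_diag A) Pu Dreal => P D Pu Dreal AE.
pose lam i := complex.Re (D 0 i).
have lamE i : D 0 i = real_complex R (lam i).
  by rewrite RRe_real//; exact: (mxOverP Dreal).
exists lam; split.
- move=> i; rewrite -lamE; apply/eigenvalueP.
  exists (delta_mx 0 i *m P).
    rewrite -/A [in LHS]AE !mulmxA mulmxK// -(rowE i (diag_mx D)) row_diag_mx.
    by rewrite -scalemxAl.
  apply/eqP => /(congr1 (mulmx^~ (invmx P))); rewrite mulmxK// mul0mx.
  move=> /matrixP/(_ 0 i); rewrite !mxE !eqxx/= => /eqP; rewrite oner_eq0.
  by [].
- move=> k; apply: (@complexI R).
  rewrite -trace_map_mx (rmorphXn (map_mx (real_complex R)))/= -/A.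
  have -> : A ^+ k = invmx P *m diag_mx D ^+ k *m P.
    elim: k => [|k IH]; first by rewrite !expr0 mulmx1 mulVmx.
    have -> : A ^+ k.+1 = A *m A ^+ k by exact: exprS.
    have -> : diag_mx D ^+ k.+1 = diag_mx D *m diag_mx D ^+ k by exact: exprS.
    by rewrite IH {1}AE !mulmxA mulmxK.
  rewrite mxtrace_mulC mulmxA mulmxV// mul1mx.
  have -> : diag_mx D ^+ k = diag_mx (map_mx (fun x => x ^+ k) D).
    elim: k => [|k IH].
      by rewrite expr0; apply/matrixP => i j; rewrite !mxE.
    have -> : diag_mx D ^+ k.+1 = diag_mx D *m diag_mx D ^+ k by exact: exprS.
    by rewrite IH mul_diag_mx; apply/matrixP => i j; rewrite !mxE exprS mulrnAr.
  rewrite mxtrace_diag rmorph_sum/=; apply: eq_bigr => i _.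
  by rewrite mxE lamE rmorphXn.
- apply: (@complexI R); rewrite -det_map_mx rmorph_prod/=.
  rewrite map_mxB map_mx1 -/A.
  have -> : 1%:M - A = invmx P *m (1%:M - diag_mx D) *m P.
    by rewrite mulmxBr mulmxBl mulmx1 mulVmx -?AE.
  rewrite !det_mulmx mulrAC -det_mulmx mulVmx// det1 mul1r.
  rewrite -diag_const_mx -linearB/= det_diag; apply: eq_bigr => i _.
  by rewrite !mxE lamE rmorphB rmorph1.
Qed.

(** A [sup] dominates its elements only if the set is bounded. The bound used is the sum of the
    moduli of all roots of the characteristic polynomial. *)
Lemma eigenvalue_normc_le n (M : 'M[R]_n) (z : R[i]) :
  eigenvalue (map_mx (real_complex R) M) z ->
  Normc.normc z <= spectral_radius M.
Proof.
move=> ez; apply: ub_le_sup; last by exists z.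
have [r rE] := closed_field_poly_normal (char_poly (map_mx (real_complex R) M)).
exists (\sum_(w <- r) Normc.normc w) => _ [w /= ew <-].
have wr : w \in r.
  move: ew; rewrite eigenvalue_root_char rE rootZ ?root_prod_XsubC//.
  by rewrite (monicP (char_poly_monic _)) oner_eq0.
have normc_ge0 (v : R[i]) : 0 <= Normc.normc v.
  by case: v => a b; exact: sqrtr_ge0.
rewrite (perm_big _ (perm_to_rem wr)) big_cons lerDl.
by apply: sumr_ge0 => v _; exact: normc_ge0.
Qed.

Lemma normc_real (x : R) : Normc.normc (real_complex R x) = `|x|.
Proof. by rewrite /= expr0n/= addr0 sqrtr_sqr. Qed.

End spectrum.

(** * Rooted and unrooted loops *)

Section walks.
Variables (A : finType) (V : nmodType) (H : A -> A -> V -> V).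
Hypothesis H0 : forall x y, H x y 0 = 0.
Hypothesis HD : forall x y, {morph H x y : u v / u + v}.

(* H x y is the effect of the step (x, y) on V: multiplication by q(x, y) when
   traces are computed, and multiplication by q(x, y) times the formal variable
   of the edge (so V is a space of coefficient families) for currents. *)
Fixpoint walk_sum (f : V) (n : nat) (x y : A) : V :=
  if n is m.+1 then \sum_w H x w (walk_sum f m w y)
  else if x == y then f else 0.

Definition along (s : seq (A * A)) (f : V) : V :=
  foldr (fun p => H p.1 p.2) f s.

Lemma big_tuple_cons (U : nmodType) (n : nat) (F : n.+1.-tuple A -> U) :
  \sum_t F t = \sum_(x : A) \sum_(s : n.-tuple A) F [tuple of x :: s].
Proof.
rewrite pair_big/= (reindex (fun p : A * n.-tuple A => [tuple of p.1 :: p.2]))//.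
exists (fun t => (thead t, [tuple of behead t])) => [[x s] _|t _].
  by congr pair; apply: val_inj.
by rewrite /= -tuple_eta.
Qed.

Lemma walk_sumS f n x y :
  walk_sum f n.+1 x y = \sum_w H x w (walk_sum f n w y).
Proof. by []. Qed.

Lemma walk_sum_path f n x y :
  walk_sum f n.+1 x y =
  \sum_(s : n.-tuple A) along (zip (x :: s) (rcons s y)) f.
Proof.
elim: n x => [|n IH] x.
  rewrite /= (bigD1 y)//= eqxx big1 ?addr0 => [|w /negPf ->]; last exact: H0.
  by rewrite (big_pred1 [tuple])// => t; apply/esym/eqP; exact: tuple0.
rewrite walk_sumS big_tuple_cons; apply: eq_bigr => w _.
rewrite IH (big_morph _ (HD x w) (H0 x w)).
by apply: eq_bigr => s _.
Qed.

Lemma walk_sum_trace f n :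
  \sum_x walk_sum f n.+1 x x = \sum_(t : n.+1.-tuple A) along (steps t) f.
Proof.
rewrite big_tuple_cons; apply: eq_bigr => x _; rewrite walk_sum_path.
by apply: eq_bigr => s _; rewrite /steps /= rot1_cons.
Qed.

End walks.

Section loops_of.
Variable A : finType.
Local Open Scope quotient_scope.
Implicit Types (l : loop A) (s : seq A).

Lemma steps_rot i s : steps (rot i s) = rot i (steps s).
Proof.
have zdrop k (u v : seq A) : zip (drop k u) (drop k v) = drop k (zip u v).
  by elim: k u v => [|k IH] [|x u] [|y v]//=; case: (drop k _).
have ztake k (u v : seq A) : zip (take k u) (take k v) = take k (zip u v).
  by elim: k u v => [|k IH] [|x u] [|y v]//=; rewrite IH.
rewrite /steps rot_rot {1 3}/rot zip_cat ?size_drop ?size_rot//.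
by rewrite zdrop ztake.
Qed.

Fact tuple_neq0 n (t : n.+1.-tuple A) : (t : seq A) != [::].
Proof. by rewrite -size_eq0 size_tuple. Qed.

Definition loop_of_tuple n (t : n.+1.-tuple A) : loop A :=
  \pi_(loop A) (RootedLoop (tuple_neq0 t)).

(** The index is the length minus one, so that nonemptiness is automatic. *)
Definition loops_of (n : nat) : {fset loop A} :=
  [fset loop_of_tuple t | t in [set: n.+1.-tuple A]%SET]%fset.

Lemma loop_seq_neq0 l : loop_seq l != [::].
Proof. exact: rooted_seqP. Qed.

Lemma loop_of_tupleP n (t : n.+1.-tuple A) l :
  reflect (exists i, tval t = rot i (loop_seq l)) (loop_of_tuple t == l).
Proof.
rewrite -[X in _ == X]reprK eq_sym eqmodE.
exact: (loop_equivP (repr l) (RootedLoop (tuple_neq0 t))).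
Qed.

Lemma loop_of_tuple_rot n (t : n.+1.-tuple A) :
  exists i, tval t = rot i (loop_seq (loop_of_tuple t)).
Proof. exact/loop_of_tupleP. Qed.

Lemma size_loop_of_tuple n (t : n.+1.-tuple A) :
  size (loop_seq (loop_of_tuple t)) = n.+1.
Proof.
by have [i /(congr1 size)] := loop_of_tuple_rot t; rewrite size_rot size_tuple.
Qed.

Lemma perm_steps_loop_of_tuple n (t : n.+1.-tuple A) :
  perm_eq (steps (loop_seq (loop_of_tuple t))) (steps t).
Proof.
by have [i ->] := loop_of_tuple_rot t; rewrite steps_rot perm_sym perm_rot.
Qed.

Lemma in_loops_of n l : (l \in loops_of n) = (size (loop_seq l) == n.+1).
Proof.
apply/imfsetP/eqP => [[t _ ->]|sl]; first exact: size_loop_of_tuple.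
have tP : size (loop_seq l) == n.+1 by apply/eqP.
exists (Tuple tP); first by rewrite inE.
by apply/esym/eqP/loop_of_tupleP; exists 0; rewrite rot0.
Qed.

Lemma card_loop_of_tuple n l : l \in loops_of n ->
  #|[pred t : n.+1.-tuple A | loop_of_tuple t == l]| = nrepr l.
Proof.
rewrite in_loops_of => /eqP sl; rewrite cardE -(size_map (@tval _ _)).
apply/perm_size/uniq_perm.
- by rewrite map_inj_uniq ?enum_uniq//; exact: val_inj.
- exact: undup_uniq.
move=> s; rewrite mem_undup; apply/mapP/(mem_shifts _ (loop_seq_neq0 l)).
- move=> [t]; rewrite mem_enum inE => /loop_of_tupleP[i ti] ->.
  by exists i.
- move=> [i si]; have tP : size s == n.+1 by rewrite si size_rot sl.
  exists (Tuple tP) => //; rewrite mem_enum inE; apply/loop_of_tupleP.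
  by exists i.
Qed.

(** Fibre counting: [loop_of_tuple] takes the value l on exactly [nrepr l] tuples. This is how s_l
    in the loop measure turns unrooted loops into rooted ones, for the traces as well as for the
    recursion. *)
Lemma sum_loops_of (R : pzSemiRingType) n (g : loop A -> R) :
  \sum_(l <- loops_of n) (nrepr l)%:R * g l =
  \sum_(t : n.+1.-tuple A) g (loop_of_tuple t).
Proof.
transitivity (\sum_(l <- loops_of n)
    \sum_(t : n.+1.-tuple A | loop_of_tuple t == l) g l).
  apply: eq_big_seq => l lA.
  by rewrite sumr_const card_loop_of_tuple// mulr_natl.
rewrite (exchange_big_dep predT)//=; apply: eq_bigr => t _.
rewrite big_mkcond/= (bigD1_seq (loop_of_tuple t))/= ?fset_uniq//; last first.
  by rewrite in_loops_of size_loop_of_tuple.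
by rewrite eqxx big1 ?addr0// => l; rewrite eq_sym => /negPf ->.
Qed.

End loops_of.

(** * Gaussian side of the current recursion *)

Lemma sum_eq_op (T : finType) (a : T) : (\sum_x (x == a) = 1)%N.
Proof.
by rewrite (bigD1 a)//= eqxx big1 ?addn0// => x /negPf ->.
Qed.

Section edges.
Variable A : finType.
Implicit Types (e : edge A) (x y z w : A).

Lemma edge_ofC x y : edge_of x y = edge_of y x.
Proof. by apply: val_inj; rewrite /= finset.setUC. Qed.

Lemma edge_ends_edge_of x y z : edge_ends (edge_of x y) z = ((z == x) + (z == y))%N.
Proof.
rewrite /edge_ends /= !inE cards2.
case: (eqVneq x y) => [->|xy]; first by case: (z == y).
case: (eqVneq z x) => [->|zx]/=; first by rewrite (negPf xy).
by case: (z == y).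
Qed.

Lemma mem_edge_of x e : x \in edge_set e -> exists w, e = edge_of x w.
Proof.
move=> xe; have /andP[e0 e2] := edge_setP e.
have [/eqP/cards1P[a ea]|e1] := eqVneq #|edge_set e| 1%N.
  exists x; apply: val_inj => /=.
  by move: xe; rewrite ea !inE => /eqP ->; rewrite finset.setUid.
have /cards2P[a [b [ab eab]]] : #|edge_set e| == 2%N.
  by rewrite eqn_leq e2 ltn_neqAle eq_sym e1.
move: xe; rewrite eab !inE => /orP[]/eqP ->.
  by exists b; apply: val_inj.
by exists a; rewrite edge_ofC; apply: val_inj.
Qed.

Lemma edge_of_inj x : injective (edge_of x).
Proof.
move=> w w' /(congr1 (fun e => edge_ends e w)); rewrite !edge_ends_edge_of eqxx.
by move=> /addnI; case: (w =P w').
Qed.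

(** The edges at x correspond bijectively to their other end w, the self-edge to w = x. The
    coefficient is what the halving in [dweight] calls for: (1 + (w == x)) theta_e/2 = q(x, w). *)
Lemma sum_edge_ends_mul (R : pzSemiRingType) x (F : edge A -> R) :
  \sum_e (edge_ends e x)%:R * F e = \sum_w (1 + (w == x))%:R * F (edge_of x w).
Proof.
rewrite (bigID (fun e => x \in edge_set e))/= [X in _ + X]big1 ?addr0; last first.
  by move=> e xe; rewrite /edge_ends xe mul0r.
rewrite (eq_bigl (mem [set edge_of x w | w : A]%SET)); last first.
  move=> e; apply/idP/imsetP => [/mem_edge_of[w ->]|[w _ ->]]; first by exists w.
  by rewrite /= !inE eqxx.
rewrite big_imset/=; last by move=> w w' _ _; exact: edge_of_inj.
by apply: eq_bigr => w _; rewrite edge_ends_edge_of eqxx eq_sym.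
Qed.

Lemma sum_edge_ends e : (\sum_x edge_ends e x = 2)%N.
Proof.
have [a ae] : exists a, a \in edge_set e.
  by apply/card_gt0P; case/andP : (edge_setP e).
have [b ->] := mem_edge_of ae.
under eq_bigr do rewrite edge_ends_edge_of.
rewrite big_split/=.
by rewrite !sum_eq_op.
Qed.

End edges.

Section wick.
Variables (R : realType) (A : finType) (theta : edge A -> R).
Local Notation K := {ffun edge A -> nat}.
Implicit Types (e : edge A) (x y z w : A) (k : K).

Definition kdel k e : K := [ffun f => (k f - (f == e))%N].

Definition ksize k : nat := (\sum_e k e)%N.

(** The test guards the truncated subtraction in [kdel]: a monomial that does not contain the
    variable of the edge has coefficient 0 in a multiple of it. *)
Definition edge_shift x y (f : K -> R) : K -> R := fun k =>
  dweight theta x y *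
  (if (0 < k (edge_of x y))%N then f (kdel k (edge_of x y)) else 0).

Lemma edge_shift0 x y : edge_shift x y 0 = 0.
Proof. by apply/funext => k; rewrite /edge_shift /= if_same mulr0. Qed.

Lemma edge_shiftD x y : {morph edge_shift x y : f g / f + g}.
Proof.
move=> f g; apply/funext => k; rewrite /edge_shift [in RHS]/GRing.add/= -mulrDr.
by case: ifP => // _; rewrite addr0.
Qed.

Definition kdeg k x : nat := (\sum_e k e * edge_ends e x)%N.

(** The moments E[N^j] of a standard normal N: (j-1)!! for even j, 0 for odd j. Given by their
    recursion, so that the coefficient identities involve no integral. *)
Fixpoint normal_moment (j : nat) : nat :=
  if j is i.+1 then (if i is h.+1 then i * normal_moment h else 0)%N else 1%N.

Lemma normal_momentS j : normal_moment j.+1 = (j * normal_moment j.-1)%N.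
Proof. by case: j. Qed.

Definition edge_weight k : R := \prod_e ((theta e / 2) ^+ k e / (k e)`!%:R).

(* The coefficient of index k in E[prod_x N_x^(d x) exp(sum_e (theta_e/2) N^e)]
   for independent standard normal N_x. *)
Definition wick (d : A -> nat) k : R :=
  edge_weight k * \prod_x (normal_moment (kdeg k x + d x))%:R.

Lemma kdelK k e : (0 < k e)%N -> k =1 (fun f => kdel k e f + (f == e))%N.
Proof.
move=> ke f; rewrite ffunE subnK//.
by case: eqP => // ->.
Qed.

Lemma ksize_kdel k e : (0 < k e)%N -> ksize k = (ksize (kdel k e)).+1.
Proof.
move=> ke; rewrite /ksize (eq_bigr _ (fun f _ => kdelK ke f)) big_split/=.
by rewrite sum_eq_op addn1.
Qed.

Lemma kdeg_kdel k x w z : (0 < k (edge_of x w))%N ->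
  kdeg k z = (kdeg (kdel k (edge_of x w)) z + (z == x) + (z == w))%N.
Proof.
move=> ke; rewrite /kdeg.
under eq_bigr do rewrite (kdelK ke) mulnDl.
rewrite big_split/= -addnA -edge_ends_edge_of; congr (_ + _)%N.
rewrite (bigD1 (edge_of x w))//= eqxx mul1n big1 ?addn0// => f /negPf ->.
by rewrite mul0n.
Qed.

Lemma edge_weight_kdel k e : (0 < k e)%N ->
  (k e)%:R * edge_weight k = theta e / 2 * edge_weight (kdel k e).
Proof.
move=> ke; rewrite /edge_weight (bigD1 e)//= [in RHS](bigD1 e)//= !mulrA.
congr (_ * _); last first.
  by apply: eq_bigr => f /negPf fe; rewrite ffunE fe subn0.
rewrite ffunE eqxx; case: (k e) ke => // n _.
rewrite subn1/= factS natrM exprS.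
field.
by rewrite nat1r !pnatr_eq0 -!lt0n fact_gt0.
Qed.

(** Shared by integration by parts and by the count of edge ends. Multiplying by [k e] lowers the
    factorial and frees a factor theta_e/2, which (1 + (w == x)) completes to q(x, w). The
    hypothesis identifies the exponents [g] after the deletion; without an edge to delete both sides
    are 0. *)
Lemma edge_shift_wick x w k (d : A -> nat) (g : A -> nat) :
  ((0 < k (edge_of x w))%N ->
     forall z, kdeg (kdel k (edge_of x w)) z + d z = g z)%N ->
  (1 + (w == x))%:R * (k (edge_of x w))%:R *
    (edge_weight k * \prod_z (normal_moment (g z))%:R) =
  edge_shift x w (wick d) k.
Proof.
move=> dg; rewrite /edge_shift; case: ltnP => [k0|]; last first.
  by rewrite leqn0 => /eqP ->; rewrite !(mulr0, mul0r).
rewrite (_ : \prod_z _ =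
    \prod_z (normal_moment (kdeg (kdel k (edge_of x w)) z + d z))%:R); last first.
  by apply: eq_bigr => z _; rewrite dg.
rewrite mulrA -(mulrA (1 + _)%:R) edge_weight_kdel// /wick !mulrA.
congr (_ * _ * _); rewrite /dweight; case: eqVneq => [->|_].
  by rewrite addn1 mulrAC mulfV ?mul1r.
by rewrite addn0 mul1r.
Qed.

(* E[N_x f(N)] = E[(d f / d N_x)(N)] with f = N_y exp(...). *)
Lemma wick_by_parts x y k :
  wick (fun z => (z == x) + (z == y))%N k =
  (if x == y then wick (fun=> 0%N) k else 0) +
  \sum_w edge_shift x w (wick (fun z => (z == w) + (z == y))%N) k.
Proof.
(* Exponents left after E[N_x^(j+1)] = j E[N_x^(j-1)] with j = kdeg k x + (x == y). The truncation
   in [.-1] at j = 0 is harmless because of the factor j. *)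
pose g z := if z == x then (kdeg k x + (x == y)).-1 else (kdeg k z + (z == y))%N.
pose E := edge_weight k * \prod_z (normal_moment (g z))%:R.
have -> : wick (fun z => (z == x) + (z == y))%N k =
    (kdeg k x + (x == y))%:R * E.
  rewrite /wick /E (bigD1 x)//= [in RHS](bigD1 x)//= /g !eqxx.
  rewrite addnCA add1n normal_momentS natrM.
  rewrite [RHS]mulrCA; congr (_ * _).
  rewrite -mulrA; congr (_ * (_ * _)).
  by apply: eq_bigr => z /negPf zx; rewrite zx add0n.
(* The two parts of j: the derivative falls on the factor N_y, or on one of the factors N_x coming
   from the exponential, one for each edge end at x. *)
rewrite natrD mulrDl addrC; congr (_ + _).
  case: eqVneq => [xy|_]; last by rewrite mul0r.
  rewrite mul1r /E /wick; congr (_ * _); apply: eq_bigr => z _.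
  rewrite /g -xy eqxx; case: eqVneq => [->|_]; last by rewrite addn0.
  by rewrite addn1 addn0.
rewrite /kdeg natr_sum mulr_suml.
under eq_bigr do rewrite mulnC natrM -mulrA.
rewrite sum_edge_ends_mul; apply: eq_bigr => w _; rewrite mulrA.
apply: edge_shift_wick => k0 z; rewrite /g; case: (eqVneq z x) => [->|zx].
  rewrite [in RHS](kdeg_kdel x k0) eqxx.
  by rewrite addn1 !addSn/= addnA.
by rewrite (kdeg_kdel z k0) (negPf zx) addn0 addnA.
Qed.

(** Each edge has two ends, so |k| is half the sum of the k e over all ends. Deleting an edge lowers
    the degrees at its ends, and the insertions N_w N_x restore them: hence a two-point moment. *)
Lemma wick_euler k :
  (ksize k)%:R * wick (fun=> 0%N) k =
  2^-1 * \sum_x \sum_w edge_shift x w (wick (fun z => (z == w) + (z == x))%N) k.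
Proof.
have -> : (ksize k)%:R * wick (fun=> 0%N) k = 2^-1 *
    \sum_x \sum_e (edge_ends e x)%:R * ((k e)%:R * wick (fun=> 0%N) k).
  apply: (@mulfI _ 2) => //; rewrite [RHS]mulrA mulfV// mul1r exchange_big/=.
  rewrite /ksize natr_sum mulr_suml mulr_sumr.
  apply: eq_bigr => e _; rewrite -mulr_suml; congr (_ * _).
  by rewrite -natr_sum sum_edge_ends.
congr (_ * _); apply: eq_bigr => x _.
rewrite sum_edge_ends_mul; apply: eq_bigr => w _; rewrite mulrA.
apply: edge_shift_wick => k0 z.
by rewrite (kdeg_kdel z k0) addn0 -addnA [((z == w) + _)%N]addnC.
Qed.

(** Integration by parts is iterated at the first point. Every step uses up an edge of k, so walks
    with more than [ksize k] steps contribute nothing and the expansion stops. *)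
Lemma wick_walks n x y k : (ksize k <= n)%N ->
  wick (fun z => (z == x) + (z == y))%N k =
  \sum_(j < n.+1) walk_sum edge_shift (wick (fun=> 0%N)) j x y k.
Proof.
elim: n x k => [|n IH] x k kn.
  rewrite big_ord1 wick_by_parts/= big1 ?addr0; first by case: ifP.
  move=> w _; rewrite /edge_shift; case: ltnP => [k0|]; last by rewrite mulr0.
  by move: kn; rewrite (ksize_kdel k0).
rewrite big_ord_recl wick_by_parts/=; congr (_ + _); first by case: ifP.
under [RHS]eq_bigr do rewrite fct_sumE.
rewrite exchange_big/=; apply: eq_bigr => w _; rewrite /edge_shift -mulr_sumr.
congr (_ * _); case: ltnP => [k0|_]; last by rewrite big1.
by apply: IH; rewrite -ltnS -(ksize_kdel k0).
Qed.

Lemma wick_rec k :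
  (ksize k)%:R * wick (fun=> 0%N) k =
  2^-1 * \sum_(n < ksize k) \sum_(t : n.+1.-tuple A)
    along edge_shift (steps t) (wick (fun=> 0%N)) k.
Proof.
rewrite wick_euler; congr (_ * _).
transitivity (\sum_x \sum_(n < ksize k)
    walk_sum edge_shift (wick (fun=> 0%N)) n.+1 x x k).
  apply: eq_bigr => x _.
  under [RHS]eq_bigr do rewrite walk_sumS fct_sumE.
  rewrite exchange_big/=; apply: eq_bigr => w _; rewrite /edge_shift -mulr_sumr.
  congr (_ * _); case: ltnP => [k0|_]; last by rewrite big1.
  (* The step from x to w has used one edge, so at most [ksize k] - 1 steps remain for the way back
     to x. *)
  by rewrite (wick_walks (n := (ksize k).-1)) (ksize_kdel k0).
rewrite exchange_big/=; apply: eq_bigr => n _.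
have := congr1 (fun f => f k) (walk_sum_trace edge_shift0 edge_shiftD (wick (fun=> 0%N)) n).
by rewrite !fct_sumE.
Qed.

End wick.

(** * Loop-soup side of the current recursion *)

Section soup_currents.
Variables (R : realType) (A : finType).
Local Notation K := {ffun edge A -> nat}.
Implicit Types (e : edge A) (x y z w : A) (k : K) (l : loop A)
  (N : multiset (loop A)).

Definition step_current (s : seq (A * A)) : K :=
  [ffun e => count (fun p => edge_of p.1 p.2 == e) s].

Definition loop_current l : K := step_current (steps (loop_seq l)).

Definition kle (k k' : K) : bool := [forall e, k e <= k' e]%N.

Definition ksub (k k' : K) : K := [ffun e => k e - k' e]%N.

Lemma ksize_step_current s : ksize (step_current s) = size s.
Proof.
rewrite /ksize; under eq_bigr do rewrite ffunE.
elim: s => [|p s IH]/=; first by rewrite big1.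
by rewrite big_split/= IH; under eq_bigr do rewrite eq_sym; rewrite sum_eq_op.
Qed.

Lemma ksize_loop_current l : ksize (loop_current l) = size (loop_seq l).
Proof. by rewrite ksize_step_current size_zip size_rot minnn. Qed.

Lemma soup_current_incl N (L : {fset loop A}) e : (finsupp N `<=` L)%fset ->
  soup_current N e = (\sum_(l <- L) N l * loop_current l e)%N.
Proof.
move=> NL; rewrite ffunE (big_fset_incl _ NL); last first.
  by move=> l _ lN; rewrite fsfun_dflt.
by apply: eq_bigr => l _; rewrite ffunE.
Qed.

Lemma ksize_soup_current N :
  ksize (soup_current N) = (\sum_(l <- finsupp N) N l * size (loop_seq l))%N.
Proof.
rewrite /ksize; under eq_bigr do rewrite (soup_current_incl _ (fsubset_refl _)).
rewrite exchange_big/=; apply: eq_bigr => l _; rewrite -big_distrr/=.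
by rewrite -ksize_loop_current.
Qed.

Lemma soup_current_bound N l : l \in finsupp N ->
  (N l * size (loop_seq l) <= ksize (soup_current N))%N.
Proof.
by move=> lN; rewrite ksize_soup_current (big_fsetD1 l)//= leq_addr.
Qed.

Lemma size_loop_seq_gt0 l : (0 < size (loop_seq l))%N.
Proof. by rewrite lt0n size_eq0 loop_seq_neq0. Qed.

Lemma soup_current_eq0 N : ksize (soup_current N) = 0%N -> N = mset0.
Proof.
move=> N0; apply/msetP => l; rewrite mset0E.
have [lN|/fsfun_dflt//] := boolP (l \in finsupp N).
have := soup_current_bound lN; rewrite N0 leqn0 muln_eq0 => /orP[/eqP//|].
by rewrite -leqn0 leqNgt size_loop_seq_gt0.
Qed.

(** A loop of a soup with current k has length at most |k| and multiplicity at most |k|, so the soup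
    is coded by a function between finite sets. The [signed_sum] in [current_measure] is therefore a
    finite sum. *)
Lemma finite_soup_current k : finite_set [set N | soup_current N = k].
Proof.
pose B := ksize k.
pose L := (\bigcup_(n <- iota 0 B) loops_of A n)%fset.
pose g (f : {ffun L -> 'I_B.+1}) : multiset (loop A) :=
  [fsfun l : L => f l : nat | 0%N].
apply: (@sub_finite_set _ _ (g @` setT)); last first.
  by apply: finite_image; exact: finite_finset.
move=> N /= Nk; exists [ffun l : L => inord (N (val l))] => //.
have NB l : l \in finsupp N -> (size (loop_seq l) <= B)%N /\ (N l <= B)%N.
  move=> lN; have := soup_current_bound lN; rewrite Nk -/B => lB.
  have N0 : (0 < N l)%N by rewrite lt0n mset_neq0 -msuppE.
  have := size_loop_seq_gt0 l => l0.
  by split; apply: leq_trans lB; [exact: leq_pmull|exact: leq_pmulr].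
apply/msetP => l; rewrite fsfun_ffun; case: insubP => [u uL ul|lL] /=.
  rewrite ffunE ul inordK// ltnS.
  by have [/NB[]//|lN] := boolP (l \in finsupp N); rewrite fsfun_dflt.
rewrite fsfun_dflt//; apply: contra lL => /NB[lB _].
apply/bigfcupP; exists (size (loop_seq l)).-1; last first.
  by rewrite in_loops_of prednK ?size_loop_seq_gt0.
by rewrite mem_iota/= add0n prednK ?size_loop_seq_gt0// andbT.
Qed.

End soup_currents.

Section soup_weight.
Variables (R : realType) (A : finType) (a : loop A -> R).
Local Notation K := {ffun edge A -> nat}.
Implicit Types (e : edge A) (x y z w : A) (k : K) (l : loop A)
  (N : multiset (loop A)).

(** The soup without its normalizing factor; [a l] stands for t m(l). *)
Definition soup_weight N : R :=
  \prod_(l <- finsupp N) (a l ^+ N l / (N l)`!%:R).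

Definition current_weight k : R :=
  \sum_(N <- fset_set [set N | soup_current N = k]) soup_weight N.

Lemma soup_weight_incl N (L : {fset loop A}) : (finsupp N `<=` L)%fset ->
  soup_weight N = \prod_(l <- L) (a l ^+ N l / (N l)`!%:R).
Proof.
move=> NL; rewrite /soup_weight (big_fset_incl _ NL)// => l _ lN.
by rewrite fsfun_dflt// expr0 fact0 invr1 mulr1.
Qed.

Local Open Scope mset_scope.

Lemma soup_current_mset1D l N e :
  soup_current (l +` N) e = (loop_current l e + soup_current N e)%N.
Proof.
have NL : (finsupp N `<=` finsupp (l +` N))%fset.
  by apply/fsubsetP => l'; rewrite !msuppE => ?; exact: mset1Dr.
rewrite (soup_current_incl _ NL) (soup_current_incl _ (fsubset_refl _)).
under eq_bigr do rewrite mset1DE mulnDl.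
rewrite big_split/=; congr (_ + _)%N.
rewrite (big_fsetD1 l)/=; last by rewrite msuppE mset1D1.
rewrite eqxx mul1n big_seq big1 ?addn0// => l'.
by rewrite in_fsetD1 => /andP[/negPf ->]; rewrite mul0n.
Qed.

Lemma soup_weight_mset1D l N :
  ((l +` N) l)%:R * soup_weight (l +` N) = a l * soup_weight N.
Proof.
have NL : (finsupp N `<=` finsupp (l +` N))%fset.
  by apply/fsubsetP => l'; rewrite !msuppE => ?; exact: mset1Dr.
have lN : l \in finsupp (l +` N) by rewrite msuppE mset1D1.
rewrite (soup_weight_incl NL) (soup_weight_incl (fsubset_refl _)).
rewrite (big_fsetD1 l)//= [in RHS](big_fsetD1 l)//= !mulrA; congr (_ * _).
  rewrite mset1DE eqxx add1n factS exprS natrM.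
  by rewrite invfM mulrACA mulfV ?pnatr_eq0// mul1r.
rewrite big_seq [in RHS]big_seq; apply: eq_bigr => l'.
by rewrite in_fsetD1 mset1DE => /andP[/negPf -> _].
Qed.

Lemma sum_soup_weight l k :
  \sum_(N <- fset_set [set N | soup_current N = k]) (N l)%:R * soup_weight N =
  a l * (if kle (loop_current l) k
         then current_weight (ksub k (loop_current l)) else 0).
Proof.
rewrite (bigID (fun N => l \in N))/= [X in _ + X]big1 ?addr0; last first.
  by move=> N /mset_eq0P ->; rewrite mul0r.
have fS j := in_fset_set (@finite_soup_current A j).
case: ifPn => [/forallP lk|lk]; last first.
  rewrite mulr0 big_seq_cond big1// => N /andP[].
  rewrite fS => /set_mem/= Nk lN; case/negP: lk; apply/forallP => e.
  by rewrite -Nk -(msetB1K lN) soup_current_mset1D leq_addr.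
rewrite big_fset_condE (eq_fbigl _ _ (B := [fset l +` N | N in
   fset_set [set N | soup_current N = ksub k (loop_current l)]]%fset))/=.
  rewrite big_imfset/=; last first.
    by move=> N N' _ _ /(congr1 (fun M => M `\ l)); rewrite !msetD1K.
  by rewrite mulr_sumr; apply: eq_bigr => N _; rewrite soup_weight_mset1D.
move=> N; apply/idP/imfsetP => /=.
  rewrite !inE/= fS => /andP[/set_mem/= Nk lN]; exists (N `\ l).
    rewrite fS; apply/mem_set => /=; apply/ffunP => e.
    by rewrite [RHS]ffunE -Nk -[in RHS](msetB1K lN) soup_current_mset1D addKn.
  by rewrite msetB1K.
move=> [N']; rewrite fS => /set_mem/= N'k ->.
rewrite !inE/= fS mset1D1 andbT; apply/mem_set => /=; apply/ffunP => e.
by rewrite soup_current_mset1D N'k [ksub _ _ _]ffunE subnKC.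
Qed.

End soup_weight.

Section current_measure.
Variables (R : realType) (A : finType) (theta : edge A -> R).
Local Notation K := {ffun edge A -> nat}.
Implicit Types (e : edge A) (x y z w : A) (k : K) (l : loop A)
  (N : multiset (loop A)).

(** The edges are deleted one at a time; the successive positivity tests amount to a single
    comparison with the current of the whole path. *)
Lemma along_edge_shift s (f : K -> R) k :
  along (edge_shift theta) s f k =
  \prod_(p <- s) dweight theta p.1 p.2 *
  (if kle (step_current s) k then f (ksub k (step_current s)) else 0).
Proof.
elim: s k => [|p s IH] k /=.
  rewrite big_nil mul1r ifT; last by apply/forallP => e; rewrite ffunE.
  by congr f; apply/ffunP => e; rewrite !ffunE subn0.
rewrite big_cons /edge_shift -mulrA; congr (_ * _).
set e := edge_of p.1 p.2; case: ltnP => [k0|].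
  rewrite IH; congr (_ * _).
  have -> : kle (step_current s) (kdel k e) = kle (step_current (p :: s)) k.
    apply: eq_forallb => j; rewrite !ffunE /= -/e eq_sym.
    case: eqVneq => [<-|_]; last by rewrite subn0.
    by rewrite leq_subRL.
  case: ifP => // _; congr f; apply/ffunP => j.
  by rewrite !ffunE /= -/e eq_sym subnDA.
rewrite leqn0 => /eqP k0; rewrite ifF ?mulr0//; apply/negP => /forallP/(_ e).
by rewrite ffunE /= -/e eqxx k0.
Qed.

Lemma size_loops_of n l : l \in loops_of A n -> size (loop_seq l) = n.+1.
Proof. by rewrite in_loops_of => /eqP. Qed.

(** The steps of the soup are grouped by the length of their loop; no loop is longer than the total
    number of steps, so the range of n misses nothing. *)
Lemma ksize_sum_loops_of N : (ksize (soup_current N) =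
  \sum_(n < ksize (soup_current N)) \sum_(l <- loops_of A n) N l * n.+1)%N.
Proof.
rewrite {1}ksize_soup_current; set B := ksize _.
transitivity (\sum_(l <- finsupp N) \sum_(n < B)
    if size (loop_seq l) == n.+1 then N l * n.+1 else 0)%N.
  apply: eq_big_seq => l lN.
  have lB : ((size (loop_seq l)).-1 < B)%N.
    rewrite prednK ?size_loop_seq_gt0//; apply: leq_trans (soup_current_bound lN).
    by rewrite leq_pmull// lt0n mset_neq0 -msuppE.
  rewrite (bigD1 (Ordinal lB))//= prednK ?size_loop_seq_gt0// eqxx.
  rewrite big1 ?addn0// => n; apply: contraNeq; case: ifP => // /eqP ln _.
  by apply/eqP/val_inj; rewrite /= ln.
rewrite exchange_big/=; apply: eq_bigr => n _; rewrite -big_mkcond/=.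
transitivity (\sum_(l <- finsupp N | l \in loops_of A n) N l * n.+1)%N.
  by apply: eq_bigl => l; rewrite in_loops_of.
rewrite [RHS](bigID (fun l => l \in finsupp N))/= [X in (_ + X)%N]big1 ?addn0; last first.
  by move=> l lN; rewrite fsfun_dflt.
rewrite big_fset_condE [RHS]big_fset_condE; apply: eq_fbigl => l.
by rewrite !inE/= andbC.
Qed.

Let a l := 2^-1 * loop_measure theta l.

Lemma current_weight_rec k :
  (ksize k)%:R * current_weight a k =
  2^-1 * \sum_(n < ksize k) \sum_(t : n.+1.-tuple A)
    along (edge_shift theta) (steps t) (current_weight a) k.
Proof.
have fS := in_fset_set (@finite_soup_current A k).
transitivity (\sum_(n < ksize k) \sum_(l <- loops_of A n)
  n.+1%:R * \sum_(N <- fset_set [set N | soup_current N = k])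
    (N l)%:R * soup_weight a N).
  rewrite {1}/current_weight mulr_sumr.
  under [RHS]eq_bigr do under eq_bigr do rewrite mulr_sumr.
  under [RHS]eq_bigr do rewrite exchange_big/=.
  rewrite exchange_big/=; apply: eq_big_seq => N; rewrite fS => /set_mem/= Nk.
  rewrite -{1}Nk ksize_sum_loops_of Nk natr_sum mulr_suml.
  apply: eq_bigr => n _; rewrite natr_sum mulr_suml; apply: eq_bigr => l _.
  by rewrite natrM mulrA [X in X * _]mulrC.
rewrite mulr_sumr; apply: eq_bigr => n _.
pose g l := loop_weight theta l * (if kle (loop_current l) k
         then current_weight a (ksub k (loop_current l)) else 0).
transitivity (2^-1 * \sum_(l <- loops_of A n) (nrepr l)%:R * g l).
  rewrite mulr_sumr; apply: eq_big_seq => l ln.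
  rewrite sum_soup_weight mulrA /g; rewrite !mulrA; congr (_ * _).
  rewrite /a /loop_measure (size_loops_of ln).
  by rewrite mulrC !mulrA mulVf ?mul1r// pnatr_eq0.
rewrite sum_loops_of; congr (_ * _); apply: eq_bigr => t _.
have tp := perm_steps_loop_of_tuple t.
rewrite along_edge_shift /g /loop_weight (perm_big _ tp)/=.
rewrite (_ : loop_current (loop_of_tuple t) = step_current (steps t))//.
by apply/ffunP => e; rewrite !ffunE; apply/permP.
Qed.

Lemma current_weight_wick k : current_weight a k = wick theta (fun=> 0%N) k.
Proof.
have [n] := ubnP (ksize k); elim: n k => // n IH k kn.
have [k0|k0] := eqVneq (ksize k) 0%N.
  have kE e : k e = 0%N by move/eqP: k0; rewrite sum_nat_eq0 => /forallP/(_ e)/eqP.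
  rewrite /current_weight.
  have -> : [set N | soup_current N = k] = [set mset0].
    apply/seteqP; split => [N /= Nk|_ -> /=]; first by apply: soup_current_eq0; rewrite Nk.
    by apply/ffunP => e; rewrite ffunE kE finsupp0 big_seq_fset0.
  rewrite fset_set1 big_seq_fset1 /soup_weight finsupp0 big_seq_fset0.
  rewrite /wick /edge_weight !big1 ?mulr1// => [x _|e _].
    by rewrite /kdeg big1//= => e _; rewrite kE.
  by rewrite kE expr0 fact0 invr1 mulr1.
have k0R : (ksize k)%:R != 0 :> R by rewrite pnatr_eq0.
apply: (mulfI k0R); rewrite current_weight_rec wick_rec; congr (_ * _).
apply: eq_bigr => -[m /= _] _; apply: eq_bigr => t _; rewrite !along_edge_shift.
congr (_ * _); case: ifP => // /forallP tk; apply: IH.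
rewrite ltnS in kn; apply: leq_trans kn.
suff -> : (ksize k = ksize (ksub k (step_current (steps t))) + size (steps t))%N.
  by rewrite -[X in (X < _)%N]addn0 ltn_add2l size_zip size_rot minnn size_tuple.
rewrite -ksize_step_current /ksize -big_split/=; apply: eq_bigr => e _.
by rewrite [ksub _ _ _]ffunE subnK.
Qed.

End current_measure.

(** * Total loop measure *)

Section exhaustion.
Variables (R : realType) (T : choiceType) (D : set T) (F : nat -> {fset T}).
Hypothesis F_nd : forall i j, (i <= j)%N -> (F i `<=` F j)%fset.
Hypothesis F_D : \bigcup_n [set` F n] = D.

(** Each finite subset of D lies in some F n, so the supremum over finite subsets is already the
    supremum of the increasing partial sums along F. *)
Lemma esum_exhaustion (g : T -> R) (B : R) : (forall x, 0 <= g x) ->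
  (forall n, \sum_(x <- F n) g x <= B) ->
  \esum_(x in D) (g x)%:E \is a fin_num /\
  \sum_(x <- F n) g x @[n --> \oo] --> fine (\esum_(x in D) (g x)%:E).
Proof.
move=> g0 gB; pose u n := \sum_(x <- F n) g x.
have sumI (X Y : {fset T}) : (X `<=` Y)%fset ->
    \sum_(x <- X) g x <= \sum_(x <- Y) g x.
  move=> XY; rewrite [leRHS](big_fsetID _ (mem X))/= -[leLHS]addr0 lerD//.
    rewrite (eq_fbigl _ _ (B := [fset x in Y | x \in X]%fset))// => x.
    by rewrite !inE/=; case: (boolP (x \in X)) => [/(fsubsetP XY) ->|]; rewrite ?andbF.
  by apply: sumr_ge0 => x _.
have u_nd : nondecreasing_seq u by move=> i j ij; apply/sumI/F_nd.
have u_ub : has_ubound (range u) by exists B => _ [n _ <-]; exact: gB.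
have ucvg := nondecreasing_cvgn u_nd u_ub.
suff -> : \esum_(x in D) (g x)%:E = (sup (range u))%:E by [].
apply/eqP; rewrite eq_le; apply/andP; split.
  apply: ge_ereal_sup => _ [X [Xfin XD] <-].
  rewrite fsbig_finite//= sumEFin lee_fin.
  have [n Xn] : exists n, (fset_set X `<=` F n)%fset.
    have /choice[h hP] : forall x, exists n, D x -> x \in F n.
      move=> x; have [Dx|nDx] := pselect (D x); last by exists 0.
      by move: Dx; rewrite -F_D => -[n _ /= xn]; exists n.
    (* The sum stands in for a maximum: it is at least each h x. *)
    exists (\sum_(x <- fset_set X) h x)%N; apply/fsubsetP => x xX.
    have Dx : D x by apply: XD; move: xX; rewrite in_fset_set// inE.
    apply: (fsubsetP (F_nd _)) (hP _ Dx).
    by rewrite (big_fsetD1 x)//= leq_addr.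
  apply: (le_trans (sumI _ _ Xn)); apply: ub_le_sup => //; exact/imageT.
rewrite -ereal_sup_EFin//; last by exists (u 0%N); exact: imageT.
apply: ge_ereal_sup => _ [_ [n _ <-] <-].
apply: ereal_sup_ubound; exists [set` F n].
  by split; [exact: finite_fset|rewrite -F_D => x xn; exists n].
by rewrite -fsbig_seq//= sumEFin.
Qed.

(** The uniform bound makes the positive and negative parts finite, so [signed_sum] is a genuine
    difference of limits. Serves the loop measure as well as the series over currents. *)
Lemma signed_sum_exhaustion (f : T -> R) (B : R) :
  (forall n, \sum_(x <- F n) `|f x| <= B) ->
  summable D (EFin \o f) /\ \sum_(x <- F n) f x @[n --> \oo] --> signed_sum D f.
Proof.
move=> fB; have [fin_abs _] := esum_exhaustion (fun x => normr_ge0 (f x)) fB.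
have sf : summable D (EFin \o f).
  by rewrite summableE.
split=> //.
pose fp x := Num.max (f x) 0; pose fn x := Num.max (- f x) 0.
have fpE : (EFin \o f)^\+%E = EFin \o fp.
  by apply/funext => x; rewrite funeposE/= /fp EFin_max.
have fnE : (EFin \o f)^\-%E = EFin \o fn.
  by apply/funext => x; rewrite funenegE/= /fn EFin_max.
have fp_le x : fp x <= `|f x| by rewrite ge_max ler_norm normr_ge0.
have fn_le x : fn x <= `|f x| by rewrite ge_max -normrN ler_norm normr_ge0.
have [fpfin fpc] := @esum_exhaustion fp B (fun x => ltac:(by rewrite le_max lexx orbT))
  (fun n => le_trans (ler_sum _ (fun x _ => fp_le x)) (fB n)).
have [fnfin fnc] := @esum_exhaustion fn B (fun x => ltac:(by rewrite le_max lexx orbT))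
  (fun n => le_trans (ler_sum _ (fun x _ => fn_le x)) (fB n)).
rewrite /signed_sum fpE fnE fineB//.
rewrite (_ : (fun n => _) =
  (fun n => \sum_(x <- F n) fp x) \- (fun n => \sum_(x <- F n) fn x)).
  exact: cvgB.
apply/funext => n /=; rewrite -sumrB; apply: eq_bigr => x _.
rewrite /fp /fn; case: (leP 0 (f x)) => fx.
  by rewrite max_r ?oppr_le0// subr0.
by rewrite max_l ?oppr_ge0 ?ltW// sub0r opprK.
Qed.

End exhaustion.

Lemma signed_sum_finite (R : realType) (T : choiceType) (D : set T) (f : T -> R) :
  finite_set D -> signed_sum D f = \sum_(x <- fset_set D) f x.
Proof.
move=> Dfin; have FD : \bigcup_(_ : nat) [set` fset_set D] = D.
  by rewrite bigcup_const ?fset_setK//; exists 0.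
have [_ /cvg_lim] := @signed_sum_exhaustion R T D (fun=> fset_set D)
  (fun _ _ _ => fsubset_refl _) FD f _ (fun=> lexx _).
by move=> <-//; rewrite lim_cst.
Qed.

Section loop_sums.
Variables (R : realType) (A : finType).
Implicit Types (theta : edge A -> R) (l : loop A).

Lemma current_measureE theta k :
  current_measure theta 2^-1 k =
  expR (- (2^-1 * total_loop_measure theta)) * wick theta (fun=> 0%N) k.
Proof.
rewrite /current_measure signed_sum_finite; last exact: finite_soup_current.
by rewrite -current_weight_wick mulr_sumr.
Qed.

Lemma trace_wmatrix theta n :
  \tr (wmatrix theta ^+ n.+1) =
  \sum_(t : n.+1.-tuple A) \prod_(p <- steps t) dweight theta p.1 p.2.
Proof.
pose H x y (v : R) := dweight theta x y * v.
have H0 x y : H x y 0 = 0 by rewrite /H mulr0.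
have HD x y : {morph H x y : u v / u + v} by move=> u v; rewrite /H mulrDr.
have walkE m x y : walk_sum H 1 m x y =
    (wmatrix theta ^+ m) (enum_rank x) (enum_rank y).
  elim: m x => [|m IH] x.
    by rewrite expr0 mxE (inj_eq enum_rank_inj)/=; case: (x == y).
  have -> : wmatrix theta ^+ m.+1 = wmatrix theta *m wmatrix theta ^+ m.
    exact: exprS.
  rewrite walk_sumS mxE (reindex enum_rank)/=; last first.
    by apply: onW_bij; exact: enum_rank_bij.
  by apply: eq_bigr => w _; rewrite IH mxE !enum_rankK.
transitivity (\sum_x walk_sum H 1 n.+1 x x).
  under [RHS]eq_bigr do rewrite walkE.
  rewrite /mxtrace (reindex enum_rank)//=.
  by apply: onW_bij; exact: enum_rank_bij.
rewrite walk_sum_trace//; apply: eq_bigr => t _; rewrite /along.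
by elim: (steps t) => [|p s IH]/=; rewrite ?big_nil// big_cons IH.
Qed.

Lemma sum_loop_measure theta n :
  \sum_(l <- loops_of A n) loop_measure theta l =
  \tr (wmatrix theta ^+ n.+1) / n.+1%:R.
Proof.
rewrite trace_wmatrix mulr_suml.
transitivity (\sum_(l <- loops_of A n) (nrepr l)%:R * (loop_weight theta l / n.+1%:R)).
  apply: eq_big_seq => l /size_loops_of ln.
  by rewrite /loop_measure ln mulrA.
rewrite sum_loops_of; apply: eq_bigr => t _.
by rewrite /loop_weight (perm_big _ (perm_steps_loop_of_tuple t)).
Qed.

Lemma norm_dweight theta x y :
  `|dweight theta x y| = dweight (fun e => `|theta e|) x y.
Proof. by rewrite /dweight; case: ifP; rewrite // normrM normfV normr_nat. Qed.

Lemma norm_wmatrix theta :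
  map_mx Num.norm (wmatrix theta) = wmatrix (fun e => `|theta e|).
Proof. by apply/matrixP => i j; rewrite !mxE norm_dweight. Qed.

Lemma norm_loop_measure theta l :
  `|loop_measure theta l| = loop_measure (fun e => `|theta e|) l.
Proof.
rewrite /loop_measure !normrM normfV !normr_nat /loop_weight normr_prod.
by under eq_bigr do rewrite norm_dweight.
Qed.

Lemma wmatrix_sym theta : (wmatrix theta)^T = wmatrix theta.
Proof.
apply/matrixP => i j; rewrite !mxE /dweight edge_ofC eq_sym.
by case: eqP => // ->.
Qed.

Definition loops_upto n : {fset loop A} :=
  (\bigcup_(m <- iota 0 n) loops_of A m)%fset.

Lemma in_loops_upto n l : (l \in loops_upto n) = (size (loop_seq l) <= n)%N.
Proof.
apply/bigfcupP/idP => [[m]|ln].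
  by rewrite mem_iota in_loops_of /= andbT => mn /eqP ->.
exists (size (loop_seq l)).-1; last first.
  by rewrite in_loops_of prednK ?size_loop_seq_gt0.
by rewrite mem_iota/= add0n prednK ?size_loop_seq_gt0// andbT.
Qed.

Lemma sum_loops_upto n (g : loop A -> R) :
  \sum_(l <- loops_upto n) g l = \sum_(m < n) \sum_(l <- loops_of A m) g l.
Proof.
transitivity (\sum_(l <- loops_upto n) \sum_(m < n)
    if l \in loops_of A m then g l else 0).
  apply: eq_big_seq => l; rewrite in_loops_upto => ln.
  have l0 := size_loop_seq_gt0 l.
  have lB : ((size (loop_seq l)).-1 < n)%N by rewrite prednK.
  rewrite (bigD1 (Ordinal lB))//= in_loops_of prednK// eqxx.
  rewrite big1 ?addr0// => m; apply: contraNeq.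
  case: ifP => [|_]; last by rewrite eqxx.
  by rewrite in_loops_of => /eqP lm _; apply/eqP/val_inj; rewrite /= lm.
rewrite exchange_big/=; apply: eq_bigr => m _; rewrite -big_mkcond/=.
rewrite big_fset_condE; apply: eq_fbigl => l.
rewrite !inE/= in_loops_upto andbC in_loops_of.
by case: eqP => //= ->; rewrite ltn_ord.
Qed.

End loop_sums.

(** * The series of -ln(1 - x) *)

Section log_series.
Variable R : realType.
Implicit Types x : R.

Let S n x : R := \sum_(m < n) x ^+ m.+1 / m.+1%:R.

Lemma log_series_error n x : `|x| < 1 ->
  `| - ln (1 - x) - S n x| <= `|x| ^+ n.+1 / (1 - `|x|).
Proof.
(* The error has derivative c^n / (1 - c). *)
move=> x1; pose g := (- (@ln R \o (fun y => 1 - y)) - S n) : R -> R.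
have dS (c : R) : is_derive c 1 (S n) (\sum_(m < n) c ^+ m).
  rewrite (_ : S n = \sum_(m < n) (m.+1%:R^-1 *: (@id R ^+ m.+1) : R -> R)); last first.
    apply/funext => y; rewrite /S fct_sumE; apply: eq_bigr => m _.
    by rewrite mulrC scalrfctE exprfctE.
  apply: is_derive_sum => m; apply: is_derive_eq.
  by rewrite /= /GRing.scale/= mulr1 mulrA mulVf ?mul1r// pnatr_eq0.
have dg (d : R) : `|d| < 1 -> is_derive d 1 g (d ^+ n / (1 - d)).
  move=> d1; have d1' : 0 < 1 - d by rewrite subr_gt0 (le_lt_trans (ler_norm _)).
  have dl : is_derive d 1 (@ln R \o (fun y => 1 - y)) ((1 - d)^-1 * -1).
    apply: is_derive1_comp; first exact: is_derive1_ln.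
    by rewrite -[X in is_derive _ _ _ X]add0r; apply: is_deriveB.
  apply: is_derive_eq.
  rewrite mulrN1 opprK; apply/(mulIf (lt0r_neq0 d1')).
  rewrite mulrBl mulVf ?gt_eqF// divfK ?gt_eqF// mulrC.
  by rewrite -[X in X * _]opprB mulNr -subrX1 opprK addrC subrK.
have g0 : g 0 = 0.
  rewrite (_ : g 0 = - ln (1 - 0) - S n 0)// subr0 ln1 oppr0 add0r /S big1 ?oppr0// => m _.
  by rewrite exprS !mul0r.
have gcont a b : (forall c, c \in `[a, b] -> `|c| < 1) ->
    {within `[a, b], continuous g}.
  move=> ab1; apply: continuous_in_subspaceT => c; rewrite inE/= => /ab1/dg dgc.
  apply: differentiable_continuous; apply/derivable1_diffP.
  exact: ex_derive.
have [c cx gx] : exists2 c, `|c| <= `|x| & g x = c ^+ n / (1 - c) * x.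
  have [x0|x0] := leP 0 x.
    have x_in c : c \in `[0, x] -> `|c| <= `|x|.
      by rewrite in_itv/= => /andP[c0 cx]; rewrite !ger0_norm.
    have [c cab|ab|c /x_in cx] := @MVT_segment R g (fun c => c ^+ n / (1 - c)) 0 x x0.
    - by apply/dg/(le_lt_trans (x_in _ (subset_itv_oo_cc cab))).
    - by apply: gcont => c /x_in cx; exact: le_lt_trans cx x1.
    - by rewrite g0 !subr0 => gx; exists c.
  have x_in c : c \in `[x, 0] -> `|c| <= `|x|.
    by rewrite in_itv/= => /andP[xc c0]; rewrite (ler0_norm c0) (ltr0_norm x0) lerN2.
  have [c cab|ab|c /x_in cx] := @MVT_segment R g (fun c => c ^+ n / (1 - c)) x 0 (ltW x0).
  - by apply/dg/(le_lt_trans (x_in _ (subset_itv_oo_cc cab))).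
  - by apply: gcont => c /x_in cx; exact: le_lt_trans cx x1.
  - by rewrite g0 !sub0r mulrN => /oppr_inj gx; exists c.
rewrite -[X in `|X|]/(g x) gx !normrM normrX normfV exprSr mulrAC.
have x1' : 0 < 1 - `|x| by rewrite subr_gt0.
have c1' : 1 - `|x| <= 1 - c.
  by rewrite lerB// (le_trans (ler_norm _)).
have c0 : 0 < 1 - c by exact: lt_le_trans c1'.
rewrite (gtr0_norm c0); apply: ler_pM.
- by rewrite mulr_ge0// exprn_ge0.
- by rewrite invr_ge0 ltW.
- by rewrite ler_wpM2r// lerXn2r// nnegrE.
- by rewrite lef_pV2// posrE.
Qed.

Lemma cvg_log_series x : `|x| < 1 ->
  \sum_(m < n) x ^+ m.+1 / m.+1%:R @[n --> \oo] --> - ln (1 - x).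
Proof.
move=> x1; apply/cvgrPdist_le => e e0.
have : `|x| * `|x| ^+ n / (1 - `|x|) @[n --> \oo] --> `|x| * 0 / (1 - `|x|).
  by apply: cvgMl; apply: cvgMr; apply: cvg_expr; rewrite normr_id.
rewrite mulr0 mul0r => /cvgrPdist_le/(_ e e0); apply: filterS => n.
rewrite sub0r normrN -exprS => ne; apply: le_trans (log_series_error n x1) _.
exact: le_trans (ler_norm _) ne.
Qed.
End log_series.

Section total_loop_measure.
Variables (R : realType) (A : finType) (theta : edge A -> R).
Hypothesis theta_integrable : integrable_weight theta.
Local Notation Q := (wmatrix theta).
Local Notation absQ := (map_mx Num.norm Q).

(** Integrability is used here: it bounds the eigenvalues of |Q|. The matrix Q itself is compared
    with |Q| through traces only, by the triangle inequality over closed walks. *)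
Lemma abs_spectrum : exists mu : 'I_#|A| -> R,
  [/\ forall i, `|mu i| < 1,
      forall k, \tr (absQ ^+ k) = \sum_i mu i ^+ k &
      forall k, `|\tr (Q ^+ k.+1)| <= \tr (absQ ^+ k.+1)].
Proof.
have /symmetric_spectrum[mu [mu_eig mu_tr _]] : absQ^T = absQ.
  by rewrite norm_wmatrix wmatrix_sym.
exists mu; split=> // [i|k].
  apply: le_lt_trans theta_integrable; rewrite -normc_real.
  exact: eigenvalue_normc_le.
rewrite norm_wmatrix !trace_wmatrix; apply: le_trans (ler_norm_sum _ _ _) _.
apply: ler_sum => t _; rewrite normr_prod.
by under eq_bigr do rewrite norm_dweight.
Qed.

Lemma wmatrix_spectrum : exists lam : 'I_#|A| -> R,
  [/\ forall i, `|lam i| < 1,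
      forall k, \tr (Q ^+ k) = \sum_i lam i ^+ k &
      \det (1%:M - Q) = \prod_i (1 - lam i)].
Proof.
have [lam [_ lam_tr lam_det]] := symmetric_spectrum (wmatrix_sym theta).
have [mu [mu1 mu_tr trQ]] := abs_spectrum.
exists lam; split=> // i; rewrite ltNge; apply/negP => lam1.
(* 1 <= lam_i^(2k) <= tr Q^(2k) <= tr |Q|^(2k), which tends to 0. *)
pose u k := \sum_j mu j ^+ (2 * k.+1).
have u1 k : 1 <= u k.
  apply: (@le_trans _ _ (\sum_j lam j ^+ (2 * k.+1))); last first.
    by rewrite /u -lam_tr -mu_tr (le_trans (ler_norm _))// mulnS trQ.
  rewrite (bigD1 i)//= -[leLHS]addr0 lerD//.
    by rewrite exprM -[lam i ^+ 2]ger0_norm ?sqr_ge0// normrX -exprM exprn_ege1.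
  by apply: sumr_ge0 => j _; rewrite exprM exprn_ge0// sqr_ge0.
have : u k @[k --> \oo] --> \sum_(j < #|A|) (0 : R).
  apply: cvg_big => [|j _].
    exact: add_continuous.
  have -> : (fun k => mu j ^+ (2 * k.+1)) = (fun k => mu j ^+ 2 * (mu j ^+ 2) ^+ k).
    by apply/funext => k; rewrite exprM exprS.
  rewrite -[X in _ --> X](mulr0 (mu j ^+ 2)); apply: cvgMr; apply: cvg_expr.
  by rewrite normrX exprn_ilt1.
rewrite big1// => /cvgrPdist_lt/(_ 1 ltr01)[k _ /(_ k (leqnn k))].
by rewrite /= sub0r normrN ltNge (le_trans (u1 k))// ler_norm.
Qed.

Let cvg_sum_trace (M : 'M[R]_#|A|) (lam : 'I_#|A| -> R) :
  (forall i, `|lam i| < 1) -> (forall k, \tr (M ^+ k) = \sum_i lam i ^+ k) ->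
  \sum_(m < n) \tr (M ^+ m.+1) / m.+1%:R @[n --> \oo] -->
    \sum_i (- ln (1 - lam i)).
Proof.
move=> lam1 lam_tr.
rewrite (_ : (fun n => _) =
    (fun n => \sum_i \sum_(m < n) lam i ^+ m.+1 / m.+1%:R)).
  apply: cvg_big => [|j _]; first exact: add_continuous.
  exact: cvg_log_series.
apply/funext => n; rewrite exchange_big/=; apply: eq_bigr => m _.
by rewrite lam_tr mulr_suml.
Qed.

Lemma sum_loops_upto_measure (th : edge A -> R) n : \sum_(l <- loops_upto A n) loop_measure th l =
  \sum_(m < n) \tr (wmatrix th ^+ m.+1) / m.+1%:R.
Proof.
by rewrite sum_loops_upto; apply: eq_bigr => m _; rewrite sum_loop_measure.
Qed.

Lemma expR_total_loop_measure :
  expR (- total_loop_measure theta) = \det (1%:M - Q).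
Proof.
have [mu [mu1 mu_tr _]] := abs_spectrum.
have [lam [lam1 lam_tr ->]] := wmatrix_spectrum.
(* The absolute values are the loop measures of |theta|, so the partial sums are increasing sums of
   traces of |Q|, bounded by their limit. *)
have bnd n : \sum_(l <- loops_upto A n) `|loop_measure theta l| <=
    \sum_i (- ln (1 - mu i)).
  under eq_bigr do rewrite norm_loop_measure.
  rewrite sum_loops_upto_measure -norm_wmatrix.
  have cv := cvg_sum_trace mu1 mu_tr.
  rewrite -(cvg_lim _ cv)//.
  apply: (@nondecreasing_cvgn_le _
    (fun n => \sum_(m < n) \tr (absQ ^+ m.+1) / m.+1%:R)); last first.
    by apply/cvg_ex; eexists; exact: cv.
  apply/nondecreasing_seqP => k; rewrite big_ord_recr/= lerDl divr_ge0//.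
  rewrite norm_wmatrix trace_wmatrix; apply: sumr_ge0 => t _.
  by apply: prodr_ge0 => p _; rewrite -norm_dweight.
have nd i j : (i <= j)%N -> (loops_upto A i `<=` loops_upto A j)%fset.
  move=> ij; apply/fsubsetP => l; rewrite !in_loops_upto => li.
  exact: leq_trans ij.
have cover : \bigcup_n [set` loops_upto A n] = [set: loop A].
  apply/seteqP; split=> // l _; exists (size (loop_seq l)) => //=.
  by rewrite in_loops_upto.
have [_] := signed_sum_exhaustion nd cover bnd.
under eq_fun do rewrite sum_loops_upto_measure.
move=> /(cvg_unique _ (cvg_sum_trace lam1 lam_tr)).
rewrite /total_loop_measure => <-//; rewrite sumrN opprK expR_sum.
apply: eq_bigr => i _; rewrite lnK// posrE subr_gt0.
exact: le_lt_trans (ler_norm _) (lam1 i).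
Qed.

End total_loop_measure.

(** * Power series over currents *)

Section exponential_sum.
Variables (R : realType) (I : finType).
Local Notation K := {ffun I -> nat}.
Implicit Types (a : I -> R) (k : K).

Definition monomial a k : R := \prod_i (a i ^+ k i / (k i)`!%:R).

Definition ffun_nat M (f : {ffun I -> 'I_M}) : K := [ffun i => f i : nat].

Definition box (M : nat) : {fset K} :=
  [fset ffun_nat f | f in [set: {ffun I -> 'I_M}]%SET]%fset.

Lemma in_box M k : (k \in box M) = [forall i, k i < M]%N.
Proof.
apply/imfsetP/forallP => [[f _ ->] i|kM]; first by rewrite ffunE.
exists [ffun i => Ordinal (kM i)]; first by rewrite /= inE.
by apply/ffunP => i; rewrite !ffunE.
Qed.

Lemma sum_box_monomial M a :
  \sum_(k <- box M) monomial a k = \prod_i series (exp_coeff (a i)) M.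
Proof.
rewrite big_imfset/=; last first.
  move=> f g _ _ /ffunP fg; apply/ffunP => i; apply/val_inj.
  by move: (fg i); rewrite !ffunE.
rewrite big_enum/=; under [RHS]eq_bigr do rewrite /series/= big_mkord.
rewrite bigA_distr_bigA/=; apply: eq_big => [f|f _]; first by rewrite inE.
by apply: eq_bigr => i _; rewrite ffunE.
Qed.

Lemma cvg_sum_box_monomial a :
  \sum_(k <- box M) monomial a k @[M --> \oo] --> expR (\sum_i a i).
Proof.
under eq_fun do rewrite sum_box_monomial.
rewrite expR_sum; apply: cvg_big => [|i _]; first exact: mul_continuous.
exact: is_cvg_series_exp_coeff.
Qed.

Lemma sum_box_monomial_le M a :
  \sum_(k <- box M) `|monomial a k| <= expR (\sum_i `|a i|).
Proof.
have -> : \sum_(k <- box M) `|monomial a k| =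
    \sum_(k <- box M) monomial (fun i => `|a i|) k.
  apply: eq_bigr => k _; rewrite normr_prod; apply: eq_bigr => i _.
  by rewrite normrM normrX normfV normr_nat.
rewrite sum_box_monomial expR_sum; apply: ler_prod => i _.
have nd : nondecreasing_seq (series (exp_coeff `|a i|)).
  apply/nondecreasing_seqP => n; rewrite seriesEnat/= big_nat_recr//= lerDl.
  by rewrite /exp_coeff /= divr_ge0// exprn_ge0.
apply/andP; split.
  by apply: sumr_ge0 => n _; rewrite /exp_coeff /= divr_ge0// exprn_ge0.
by apply: nondecreasing_cvgn_le => //; exact: is_cvg_series_exp_coeff.
Qed.

End exponential_sum.

(** * Currents as even degrees, and averaging over signs *)

Section ghat_series.
Variables (R : realType) (A : finType).
Local Notation K := {ffun edge A -> nat}.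
Implicit Types (k : K) (z : A -> R).

Lemma natr_half_int (n : nat) : ((n%:R / 2 : R) \is a Num.int) = ~~ odd n.
Proof.
apply/idP/idP => [/intrP[m nm]|/even_halfK <-]; last first.
  by rewrite -mul2n natrM mulrAC mulfV// mul1r rpred_nat.
have : n%:R = (m * 2)%:~R :> R by rewrite intrM -nm divfK.
rewrite -[n%:R]/(n%:Z%:~R) => /intr_inj.
by case: m {nm} => m nm; lia.
Qed.

Lemma currentsE k : currents R A k <-> forall x, ~~ odd (kdeg k x).
Proof.
by split=> kC x; have := kC x; rewrite /= /nvisits natr_half_int.
Qed.

(** The z^e of the overview: z_x z_y for an edge joining x to y, z_x^2 for a self-edge at x. *)
Definition edge_monomial z (e : edge A) : R := \prod_x z x ^+ edge_ends e x.

Lemma prod_edge_monomial z k :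
  \prod_e edge_monomial z e ^+ k e = \prod_x z x ^+ kdeg k x.
Proof.
under [RHS]eq_bigr do rewrite /kdeg expr_sum.
rewrite exchange_big/=; apply: eq_bigr => e _; rewrite -prodrXl.
by apply: eq_bigr => x _; rewrite mulnC exprM.
Qed.

(** Counting each edge from both ends gives the quadratic form z Q z^T / 2, the contribution of Q to
    the exponent of the normal density. *)
Lemma quadratic_edges (theta : edge A -> R) z :
  \sum_e theta e / 2 * edge_monomial z e =
  2^-1 * \sum_x \sum_y dweight theta x y * (z x * z y).
Proof.
apply: (@mulfI _ 2) => //; rewrite [RHS]mulrA mulfV// mul1r.
transitivity (\sum_x \sum_e (edge_ends e x)%:R * (theta e / 2 * edge_monomial z e)).
  rewrite exchange_big/= mulr_sumr; apply: eq_bigr => e _.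
  by rewrite -mulr_suml -natr_sum sum_edge_ends.
apply: eq_bigr => x _; rewrite sum_edge_ends_mul; apply: eq_bigr => y _.
have -> : edge_monomial z (edge_of x y) = z x * z y.
  rewrite /edge_monomial; under eq_bigr do rewrite edge_ends_edge_of exprD.
  rewrite big_split/=; congr (_ * _).
    by rewrite (bigD1 x)//= eqxx big1 ?mulr1// => w /negPf ->.
  by rewrite (bigD1 y)//= eqxx big1 ?mulr1// => w /negPf ->.
rewrite mulrA; congr (_ * _); rewrite /dweight [y == x]eq_sym.
by case: eqVneq => [->|_]; [rewrite mulrC divfK|rewrite mul1r].
Qed.

Definition flip_signs (b : {ffun A -> bool}) z : A -> R :=
  fun x => (-1) ^+ b x * z x.

(** The sum over signs factorizes over the vertices into factors 1 + (-1)^(kdeg k x), each equal to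
    2 or 0. *)
Lemma parity_projection z k :
  \sum_b \prod_e edge_monomial (flip_signs b z) e ^+ k e =
  (if [forall x, ~~ odd (kdeg k x)] then 2 ^+ #|A| else 0) *
  \prod_e edge_monomial z e ^+ k e.
Proof.
rewrite (eq_bigr _ (fun b _ => prod_edge_monomial (flip_signs b z) k)).
rewrite prod_edge_monomial.
transitivity ((\prod_x \sum_(c : bool) (-1) ^+ (c * kdeg k x)) *
    \prod_x z x ^+ kdeg k x).
  rewrite bigA_distr_bigA/= mulr_suml; apply: eq_bigr => b _.
  rewrite -big_split/=; apply: eq_bigr => x _.
  by rewrite /flip_signs exprMn exprM.
congr (_ * _); under eq_bigr do rewrite big_bool/= mul1n mul0n expr0 -signr_odd.
case: ifPn => [/forallP kC|].
  rewrite -[#|A|]cardsT -prodr_const; apply: eq_big => [x|x _]; first by rewrite inE.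
  by rewrite (negPf (kC x)).
rewrite negb_forall => /existsP[x]; rewrite negbK => kx.
by rewrite (bigD1 x)//= kx expr1 addNr mul0r.
Qed.

End ghat_series.

(** * Change of variables z = +-sqrt(2t) *)

Section density_measure.
Context d (T : measurableType d) (R : realType).
Variables (mu : {measure set T -> \bar R}) (w : T -> R).
Hypotheses (mw : measurable_fun setT w) (w0 : forall x, 0 <= w x).
Local Open Scope ereal_scope.

(* The two proof arguments are only there for the measure instance to find. *)
Definition density_measure of measurable_fun setT w & (forall x, (0 <= w x)%R) :=
  fun A : set T => \int[mu]_(x in A) (w x)%:E.

Local Notation nu := (density_measure mw w0).

Let nu0 : nu set0 = 0. Proof. exact: integral_set0. Qed.

Let nu_ge0 A : 0 <= nu A.
Proof. by apply: integral_ge0 => x _; rewrite lee_fin. Qed.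

Let nu_sigma_additive : semi_sigma_additive nu.
Proof.
move=> F mF tF mUF; rewrite /density_measure ge0_integral_bigcup//.
- apply: is_cvg_ereal_nneg_natsum_cond => n _ _.
  by apply: integral_ge0 => x _; rewrite lee_fin.
- exact/measurable_EFinP/measurable_funTS.
- by move=> x _; rewrite lee_fin.
Qed.

HB.instance Definition _ := isMeasure.Build _ _ _ nu nu0 nu_ge0 nu_sigma_additive.

Import HBNNSimple.

(** Monotone approximation by simple functions reduces this to indicators, where it is the
    definition of [density_measure]. *)
Lemma ge0_integral_density (f : T -> \bar R) :
  measurable_fun setT f -> (forall x, 0 <= f x) ->
  \int[nu]_x f x = \int[mu]_x (f x * (w x)%:E).
Proof.
move=> mf f0; pose h := nnsfun_approx measurableT mf.
have mwE : measurable_fun setT (EFin \o w) by exact/measurable_EFinP.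
have hf x : EFin \o h ^~ x @ \oo --> f x by apply: cvg_nnsfun_approx.
have h_nd : {homo (fun n x => h n x) : m n / (m <= n)%N >-> (forall x, (m x <= n x)%R)}.
  by move=> m n mn x; exact/lefP/nd_nnsfun_approx.
transitivity (limn (fun n => \int[nu]_x (h n x)%:E)).
  rewrite -monotone_convergence//.
  - by apply: eq_integral => x _; apply/esym/cvg_lim => //; exact: hf.
  - by move=> n; exact/measurable_EFinP.
  - by move=> n x _; rewrite lee_fin.
  - by move=> x _ m n mn; rewrite lee_fin h_nd.
transitivity (limn (fun n => \int[mu]_x ((h n x)%:E * (w x)%:E))); last first.
  rewrite -monotone_convergence//.
  - apply: eq_integral => x _; apply/cvg_lim => //.
    by apply: cvgeZr => //; exact: hf.
  - by move=> n; apply: emeasurable_funM => //; exact/measurable_EFinP.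
  - by move=> n x _; rewrite mule_ge0 ?lee_fin.
  - by move=> x _ m n mn; rewrite lee_wpmul2r ?lee_fin ?h_nd.
congr (limn _); apply/funext => n; rewrite integralT_nnsfun sintegralE.
transitivity (\int[mu]_x
    \sum_(y \in range (h n)) (y%:E * ((\1_(h n @^-1` [set y]) x)%:E * (w x)%:E))); last first.
  apply: eq_integral => x _; rewrite [in RHS]fimfunE -fsumEFin//.
  rewrite ge0_mule_fsuml => [|y]; last exact: nnfun_muleindic_ge0.
  by apply: eq_fsbigr => y _; rewrite muleA.
have h0 y x : 0 <= y%:E * ((\1_(h n @^-1` [set y]) x)%:E * (w x)%:E).
  by rewrite muleA mule_ge0 ?lee_fin//; exact: nnfun_muleindic_ge0.
have m1 y : measurable_fun setT
    (fun x => (\1_(h n @^-1` [set y]) x)%:E * (w x)%:E).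
  by apply: emeasurable_funM => //; exact/measurable_EFinP.
rewrite ge0_integral_fsum//; last by move=> y; exact: measurable_funeM.
apply: eq_fsbigr => y /[!inE] -[x _ hxy].
rewrite ge0_integralZl//; last by rewrite -hxy lee_fin.
  congr (_ * _).
  rewrite -[LHS]/(\int[mu]_(x in h n @^-1` [set y]) (w x)%:E) integral_mkcond.
  by apply: eq_integral => z _; rewrite epatch_indic muleC.
by move=> z _; rewrite mule_ge0 ?lee_fin.
Qed.

End density_measure.

Lemma measurable_sqrt2 (R : realType) :
  measurable_fun [set: R] (fun t => Num.sqrt (2 * t)).
Proof.
apply: (measurableT_comp (f := @Num.sqrt R)); last exact: measurable_funM.
by apply: continuous_measurable_fun; exact: sqrt_continuous.
Qed.

Lemma measurable_inv_sqrt2 (R : realType) :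
  measurable_fun [set: R] (fun t => (Num.sqrt (2 * t))^-1).
Proof.
under eq_fun do rewrite -powR_inv1 ?sqrtr_ge0//.
exact: (measurableT_comp (measurable_powR _) (@measurable_sqrt2 R)).
Qed.

Section half_square.
Variable R : realType.
Local Notation mu := (@lebesgue_measure R).
Local Open Scope ereal_scope.

(** The derivative of [psi], cut off at 0: with this density the negative half-line has no mass, so
    [psi] can be applied on the whole line although it is not injective there. *)
Let w (z : R) : R := Num.max z 0%R.
Let psi (z : R) : R := (z ^+ 2 / 2)%R.

Let w0 z : (0 <= w z)%R. Proof. by rewrite le_max lexx orbT. Qed.

Let cw : continuous w.
Proof. by move=> z; apply: continuous_max => //; exact: cst_continuous. Qed.

Let mw : measurable_fun setT w. Proof. exact: continuous_measurable_fun. Qed.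

Let dpsi (x : R) : is_derive x 1%R psi x.
Proof.
rewrite (_ : psi = 2^-1 *: (@id R ^+ 2) :> (R -> R))%R; last first.
  by apply/funext => y; rewrite /psi scalrfctE exprfctE mulrC.
apply: is_derive_eq.
by rewrite /= /GRing.scale/= expr1 mulr1 mulrA mulVf ?mul1r.
Qed.

Let cpsi : continuous psi.
Proof.
move=> x; apply: differentiable_continuous; apply/derivable1_diffP.
have dx := dpsi x; exact: ex_derive.
Qed.

Let mpsi : measurable_fun setT psi. Proof. exact: continuous_measurable_fun. Qed.

Let integral_id (c d : R) : (0 <= c <= d)%R ->
  \int[mu]_(x in `]c, d]) (w x)%:E = (d ^+ 2 / 2 - c ^+ 2 / 2)%:E.
Proof.
move=> /andP[c0]; rewrite le_eqVlt => /predU1P[<-|cd].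
  by rewrite set_itvoc0 integral_set0 subrr.
rewrite integral_itv_obnd_cbnd; last first.
  exact/measurable_EFinP/measurable_funTS.
apply: (@continuous_FTC2 _ w psi) => //.
- by apply: continuous_subspaceT.
- split.
  + move=> x _; have dx := dpsi x; exact: ex_derive.
  + exact/cvg_at_right_filter/cpsi.
  + exact/cvg_at_left_filter/cpsi.
- move=> x; rewrite in_itv/= => /andP[cx _].
  rewrite /w max_l ?(le_trans c0)// ?ltW//.
  rewrite derive1E; have dx := dpsi x; exact: derive_val.
Qed.

(** Squaring is increasing on z > 0. A negative a or b is covered as well, its [Num.sqrt] being
    0. *)
Let psi_itv (a b z : R) : (0 < z)%R ->
  (psi z \in `]a, b]) = (z \in `](Num.sqrt (2 * a)), (Num.sqrt (2 * b))])%R.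
Proof.
move=> z0; rewrite !in_itv/= /psi ltr_pdivlMr// ler_pdivrMr//.
have aux c : (Num.sqrt (2 * c) < z)%R = (c * 2 < z ^+ 2)%R.
  have [c0|c0] := leP 0%R c.
    rewrite -[in RHS]mulrC -[X in (X < z ^+ 2)%R](sqr_sqrtr (a := 2 * c)); last first.
      by rewrite mulr_ge0.
    by rewrite ltr_pXn2r// nnegrE ?sqrtr_ge0// ltW.
  rewrite ler0_sqrtr; last by rewrite mulr_ge0_le0// ltW.
  rewrite z0; apply/esym; apply: (@lt_le_trans _ _ 0%R); last exact: sqr_ge0.
  by rewrite nmulr_rlt0.
by rewrite -aux [(z ^+ 2 <= _)%R]leNgt -aux -leNgt.
Qed.

Let push_itv (a b : R) : (a < b)%R ->
  pushforward (density_measure mu mw w0) psi `]a, b] =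
  (Num.max b 0 - Num.max a 0)%:E.
Proof.
move=> ab; rewrite /pushforward /density_measure integral_mkcond.
have sqrt2 c : (Num.sqrt (2 * c) ^+ 2 / 2 = Num.max c 0)%R.
  have [c0|c0] := leP 0%R c.
    by rewrite sqr_sqrtr ?mulr_ge0// mulrAC mulfV// mul1r.
  by rewrite ler0_sqrtr ?expr0n/= ?mul0r// mulr_ge0_le0// ltW.
rewrite -!sqrt2 -integral_id; last first.
  by rewrite sqrtr_ge0 ler_wsqrtr// ler_pM2l// ltW.
rewrite [RHS]integral_mkcond; apply: eq_integral => z _.
rewrite !patchE; have [z0|z0] := ltP 0%R z.
  have -> : (z \in psi @^-1` `]a, b]) = (psi z \in `]a, b]%R).
    by apply/idP/idP => [/set_mem//|zab]; exact/mem_set.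
  by rewrite psi_itv// mem_setE.
by rewrite /w max_r//; case: ifP; case: ifP.
Qed.

(** The image of z dz misses the negative half-line. Lebesgue measure there is added back, so that
    the sum can be compared with Lebesgue measure on all intervals ]a, b], as uniqueness
    requires. *)
Let mu_itv (a b : R) : (a < b)%R ->
  mrestr mu (measurable_itv `]-oo, 0%R]) `]a, b] =
  (Num.min b 0 - Num.min a 0)%:E.
Proof.
move=> ab; rewrite /mrestr.
have -> : `]a, b] `&` `]-oo, 0%R] = `]a, (Num.min b 0)%R]%classic.
  by apply/seteqP; split=> z /=; rewrite !in_itv/= le_min;
    [move=> [/andP[-> ->] ->]|move=> /andP[-> /andP[-> ->]]].
rewrite lebesgue_measure_itv/= lte_fin lt_min ab/=.
case: (ltP a 0%R) => a0; first by rewrite EFinB.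
by rewrite min_r ?subrr// (le_trans a0)// ltW.
Qed.

Let nu : {measure set (measurableTypeR R) -> \bar R}.
Proof.
by refine (pushforward (density_measure mu mw w0) (psi : _ -> measurableTypeR R)).
Defined.

(* The image of z dz under z |-> z^2/2 is Lebesgue measure on ]0, +oo[. *)
Let muE A : measurable A -> mu A =
  @measure_add _ (measurableTypeR R) R nu
    (mrestr mu (measurable_itv `]-oo, 0%R])) A.
Proof.
apply: lebesgue_measure_unique => _ [[a b] _ <-]/=.
apply: etrans; last exact/esym/measure_addE.
have [ba|ab] := leP b a.
  by rewrite set_itv_ge ?measure0 ?adde0// -leNgt bnd_simp.
rewrite [nu _](push_itv ab) [X in _ = _ + X](mu_itv ab) lebesgue_measure_itv/= lte_fin ab -EFinD.
congr EFin; case: (leP 0%R a) => a0; case: (leP 0%R b) => b0; lra.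
Qed.

(* No restriction to t > 0 is needed: Num.sqrt is 0 on negative numbers and
   0^-1 = 0. *)
Lemma ge0_integral_sqrt (f : R -> \bar R) :
  measurable_fun setT f -> (forall x, 0 <= f x) ->
  \int[mu]_t (f (Num.sqrt (2 * t)) * ((Num.sqrt (2 * t))^-1)%:E) =
  \int[mu]_(z in `]0%R, +oo[) f z.
Proof.
move=> mf f0; pose g t := f (Num.sqrt (2 * t)) * ((Num.sqrt (2 * t))^-1)%:E.
have msqrt := @measurable_sqrt2 R.
have mg : measurable_fun setT g.
  apply: emeasurable_funM; first exact: measurableT_comp.
  by apply/measurable_EFinP; exact: measurable_inv_sqrt2.
have g0 t : 0 <= g t by rewrite mule_ge0// lee_fin invr_ge0 sqrtr_ge0.
have gE (m : {measure set (measurableTypeR R) -> \bar R}) :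
    \int[m]_t g t = \int[m]_(t in `]0%R, +oo[) g t.
  rewrite [RHS]integral_mkcond; apply: eq_integral => t _.
  rewrite patchE mem_setE in_itv/= andbT; case: ltP => // t0.
  by rewrite /g ler0_sqrtr ?invr0 ?mule0// mulr_ge0_le0.
transitivity (\int[nu]_t g t).
  rewrite [LHS]gE [RHS]gE; apply: eq_measure_integral => A mA A0.
  apply: (etrans (muE mA)); rewrite measure_addE [X in _ + X](_ : _ = 0) ?adde0//.
  rewrite -(measure0 mu); congr (mu _).
  apply/seteqP; split=> // t [/A0/=]; rewrite !in_itv/= andbT.
  by move=> /lt_le_trans/[apply]; rewrite ltxx.
transitivity (\int[density_measure mu mw w0]_z g (psi z)).
  exact: (@ge0_integral_pushforward _ _ (measurableTypeR R) (measurableTypeR R) R psi mpsi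
    (density_measure mu mw w0) setT g measurableT mg (fun y _ => g0 y)).
rewrite ge0_integral_density//; last exact: measurableT_comp.
rewrite [RHS]integral_mkcond; apply: eq_integral => z _.
rewrite patchE mem_setE in_itv/= andbT /w; case: ltP => z0; last by rewrite mule0.
rewrite /g /psi mulrC divfK// sqrtr_sqr gtr0_norm// -muleA -EFinM.
by rewrite mulVf ?gt_eqF// mule1.
Qed.

Lemma ge0_integral_signed_sqrt (f : R -> \bar R) :
  measurable_fun setT f -> (forall x, 0 <= f x) ->
  \int[mu]_z f z = \sum_(b : bool) \int[mu]_t
    (f ((-1) ^+ b * Num.sqrt (2 * t))%R * ((Num.sqrt (2 * t))^-1)%:E).
Proof.
move=> mf f0; rewrite big_bool/= expr1 expr0.
under [X in X + _]eq_integral do rewrite mulN1r.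
under [X in _ + X]eq_integral do rewrite mul1r.
have mfN : measurable_fun setT (f \o -%R) by exact: measurableT_comp.
have fN0 x : 0 <= (f \o -%R) x by exact: f0.
rewrite [X in X + _](ge0_integral_sqrt mfN fN0) ge0_integral_sqrt//.
rewrite [X in X + _]integral_itv_obnd_cbnd; last exact: measurable_funTS.
rewrite (ge0_integration_by_substitution0 mfN fN0)/=.
under [X in X + _]eq_integral do rewrite opprK.
rewrite -ge0_integral_setU//=.
- by rewrite (itv_setU_setT false 0%R).
- exact: measurable_funTS.
- by apply/eqP; rewrite -subset0 => t [/=]; rewrite !in_itv/= andbT => /le_lt_trans/[apply]; rewrite ltxx.
Qed.

End half_square.

(** * Gamma at half-integers *)

Section gaussian_moments.
Variable R : realType.
Local Notation mu := (@lebesgue_measure R).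

Let gauss (z : R) : R := expR (- (z ^+ 2 / 2)).

Let dgauss (z : R) : is_derive z 1 gauss (- z * gauss z).
Proof.
rewrite (_ : gauss = expR \o ((- 2^-1) *: (@id R ^+ 2))); last first.
  by apply/funext => y; rewrite /gauss /= scalrfctE exprfctE /GRing.scale/= mulNr [2^-1 * _]mulrC.
apply: is_derive_eq.
by rewrite /= expr1 /GRing.scale/= mulr1 mulNr mulrA mulVf ?mul1r// mulrC.
Qed.

Let dmoment k (z : R) :
  is_derive z 1 (fun z => z ^+ k.+1 * gauss z)
    (k.+1%:R * z ^+ k * gauss z - z ^+ k.+2 * gauss z).
Proof.
have dg := dgauss z.
rewrite (_ : (fun z => _) = (@id R ^+ k.+1) * gauss); last first.
  by apply/funext => y; rewrite mulrfctE exprfctE.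
apply: is_derive_eq.
rewrite exprfctE /GRing.scale/= mulr1 !exprS.
by move: (z ^+ k) (k.+1%:R : R) (gauss z) => u c g; ring.
Qed.

Let cmoment k : continuous (fun z : R => z ^+ k * gauss z).
Proof.
move=> z; apply: cvgM; first exact: exprn_continuous.
apply: differentiable_continuous; apply/derivable1_diffP.
have dg := dgauss z; exact: ex_derive.
Qed.

Let mmoment k : measurable_fun [set: R] (fun z : R => z ^+ k * gauss z).
Proof. by apply: continuous_measurable_fun; exact: cmoment. Qed.

Let moment_ge0 k z : 0 <= z ^+ k.*2 * gauss z.
Proof. by rewrite mulr_ge0 ?expR_ge0// -mul2n exprM exprn_ge0// sqr_ge0. Qed.

Let half_line k : \bar R := \int[mu]_(z in `[0, +oo[) (z ^+ k.*2 * gauss z)%:E.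

Let cvg_moment0 k : (n%:R ^+ k * gauss n%:R) @[n --> \oo] --> (0 : R).
Proof.
(* C comes from one term of the exponential series, exp(y) >= y^(k+1)/(k+1)! at y = x^2/2: it gives
   x^k exp(-x^2/2) <= C/x for x >= 1. The shift makes x = n+1. *)
rewrite -cvg_shiftS /=; pose C : R := (k.+1)`!%:R * 2 ^+ k.+1.
apply: (@squeeze_cvgr _ _ _ _ (cst 0) (fun n => C * harmonic n)); last 2 first.
- exact: cvg_cst.
- by rewrite -[X in _ --> X](mulr0 C); apply: cvgMr; exact: cvg_harmonic.
apply: nearW => n; rewrite mulr_ge0 ?exprn_ge0 ?expR_ge0//=.
set x : R := n.+1%:R; have x1 : 1 <= x by rewrite /x ler1n.
have x0 : 0 < x by exact: lt_le_trans x1.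
have y0 : 0 < x ^+ 2 / 2 by rewrite divr_gt0// exprn_gt0.
have C0 : 0 < C by rewrite mulr_gt0 ?exprn_gt0// ltr0n fact_gt0.
rewrite /gauss expRN ler_pdivrMr ?expR_gt0//.
have := expR_ge1Dxn k (ltW y0); set E := expR _ => xE.
have {}xE : (x ^+ 2 / 2) ^+ k.+1 / (k.+1)`!%:R <= E.
  by apply: le_trans xE; rewrite lerDr.
apply: (@le_trans _ _ (C * x^-1 * ((x ^+ 2 / 2) ^+ k.+1 / (k.+1)`!%:R))); last first.
  by rewrite ler_wpM2l// mulr_ge0 ?invr_ge0 ?ltW.
rewrite expr_div_n /C [leRHS](_ : _ = x ^+ 2 ^+ k.+1 / x); last first.
  by field; rewrite !gt_eqF ?exprn_gt0 ?ltr0n ?fact_gt0.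
rewrite -exprM mulnS add2n exprS mulrAC mulfV ?gt_eqF// mul1r.
by rewrite ler_weXn2l//; lia.
Qed.

(** Integration by parts on [0, n], whose boundary term tends to 0. That term is added on the left
    instead of subtracted on the right, so the limit makes sense before [half_line] is known to be
    finite. *)
Let half_lineS k : half_line k.+1 = ((k.*2.+1)%:R%:E * half_line k)%E.
Proof.
have A n : (\int[mu]_(z in `[0%R, n%:R]) (z ^+ k.+1.*2 * gauss z)%:E +
    (n%:R ^+ k.*2.+1 * gauss n%:R)%:E =
    (k.*2.+1)%:R%:E * \int[mu]_(z in `[0%R, n%:R]) (z ^+ k.*2 * gauss z)%:E)%E.
  have [->|n0] := posnP n.
    by rewrite set_itv1 !integral_set1 mule0 expr0n/= mul0r adde0.
  have N0 : (0 : R) < n%:R by rewrite ltr0n.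
  have int_moment j : mu.-integrable `[0%R, n%:R] (EFin \o (fun z => z ^+ j * gauss z)).
    apply: continuous_compact_integrable; first exact: segment_compact.
    exact/continuous_subspaceT/cmoment.
  pose F (z : R) := z ^+ k.*2.+1 * gauss z.
  pose f (z : R) := k.*2.+1%:R * z ^+ k.*2 * gauss z - z ^+ k.*2.+2 * gauss z.
  have cf : continuous f.
    move=> z; apply: cvgB; last exact: cmoment.
    under eq_fun do rewrite -mulrA.
    by rewrite -mulrA; apply: cvgMr; exact: cmoment.
  have FE : (\int[mu]_(z in `[0%R, n%:R]) (f z)%:E = (F n%:R)%:E)%E.
    rewrite (@continuous_FTC2 _ f F)//.
    - by rewrite /F expr0n/= mul0r sube0.
    - exact: continuous_subspaceT.
    - split.
      + move=> x _; have dx := dmoment k.*2 x; exact: ex_derive.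
      + exact/cvg_at_right_filter/cmoment.
      + exact/cvg_at_left_filter/cmoment.
    - by move=> x _; rewrite derive1E; have dx := dmoment k.*2 x; exact: derive_val.
  rewrite -[(_ * gauss n%:R)%:E]FE -integralD//; last 2 first.
  - exact: (int_moment k.*2.+2).
  - apply: continuous_compact_integrable; first exact: segment_compact.
    exact: continuous_subspaceT.
  rewrite -integralZl//; last exact: int_moment.
  apply: eq_integral => z _; rewrite -EFinD -EFinM /f mulrA; congr EFin.
  by rewrite addrC subrK.
have B : ((\int[mu]_(z in `[0%R, n%:R]) (z ^+ k.+1.*2 * gauss z)%:E +
    (n%:R ^+ k.*2.+1 * gauss n%:R)%:E)%E @[n --> \oo] --> half_line k.+1 + 0)%E.
  apply: cvgeD; first by rewrite fin_num_adde_defl.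
    exact: ge0_cvgn_integral.
  by apply: cvg_EFin; [exact: nearW|exact: cvg_moment0].
rewrite adde0 in B.
have C : ((k.*2.+1)%:R%:E * \int[mu]_(z in `[0%R, n%:R]) (z ^+ k.*2 * gauss z)%:E)%E
    @[n --> \oo] --> ((k.*2.+1)%:R%:E * half_line k)%E.
  by apply: cvgeZl => //; exact: ge0_cvgn_integral.
move: B; under eq_fun do rewrite A.
by move/cvg_unique; apply.
Qed.

Let half_line0 : half_line 0 = (Num.sqrt (2 * pi) / 2)%:E.
Proof.
have cpdf : continuous (@normal_pdf R 0 1).
  by apply: continuous_normal_pdf; rewrite oner_eq0.
have pdfE z : @normal_pdf R 0 1 z = (Num.sqrt (2 * pi))^-1 * gauss z.
  rewrite normal_pdfE ?oner_eq0//= /normal_peak /normal_fun /gauss subr0 expr1n mul1r.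
  by rewrite mulNr !mulr_natl.
have := @integral_normal_pdf R 0 1.
rewrite ge0_symfun_integralT//=; last 2 first.
- by move=> x; exact: normal_pdf_ge0.
- by move=> x; rewrite /= !pdfE /gauss sqrrN.
have -> : [set x : R | 0 <= x] = `[0, +oo[%classic.
  by apply/seteqP; split => x/=; rewrite in_itv/= andbT.
under eq_integral do rewrite pdfE EFinM.
have s0 : 0 < Num.sqrt (2 * pi) :> R by rewrite sqrtr_gt0 mulr_gt0// pi_gt0.
rewrite ge0_integralZl//=.
- have -> : (\int[mu]_(x in `[0%R, +oo[) (gauss x)%:E = half_line 0)%E.
    by rewrite /half_line; under [RHS]eq_integral do rewrite expr0 mul1r.
  (* A priori the value may be infinite; total mass 1 of the normal law excludes this. *)
  case: (half_line 0) => [r| |].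
  + move=> [h]; congr EFin; rewrite -[RHS]mulr1 -[X in _ = _ * X]h.
    by field; rewrite gt_eqF.
  + by rewrite gt0_muley ?lte_fin ?invr_gt0// gt0_muley.
  + by rewrite gt0_muleNy ?lte_fin ?invr_gt0// gt0_muleNy.
- apply/measurable_EFinP/measurable_funTS.
  by have := mmoment 0; under eq_fun do rewrite expr0 mul1r.
- by move=> x _; rewrite lee_fin expR_ge0.
Qed.

Let half_lineE k :
  half_line k = ((normal_moment k.*2)%:R * (Num.sqrt (2 * pi) / 2))%:E.
Proof.
elim: k => [|k IH]; first by rewrite half_line0 mul1r.
by rewrite half_lineS IH -EFinM doubleS /= natrM !mulrA.
Qed.

(** The substitution t = z^2/2 turns the Gamma integral into the moment of order 2k of the Gaussian
    on the half-line; t^k accounts for 2^-k. *)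
Lemma Gamma_half k :
  Gamma (k%:R + 2^-1 : R) = Num.sqrt pi * ((normal_moment k.*2)%:R / 2 ^+ k).
Proof.
pose f (z : R) := (2^-1 ^+ k * (z ^+ k.*2 * gauss z))%:E.
have f0 z : (0 <= f z)%E.
  by rewrite lee_fin mulr_ge0.
have mf : measurable_fun setT f.
  by apply/measurable_EFinP; apply: measurable_funM => //; exact: mmoment.
have fE : (\int[mu]_(z in `]0%R, +oo[) f z =
    (2^-1 ^+ k * ((normal_moment k.*2)%:R * (Num.sqrt (2 * pi) / 2)))%:E)%E.
  rewrite EFinM -half_lineE /half_line -integral_itv_obnd_cbnd; last first.
    by apply/measurable_EFinP; apply: measurable_funTS; exact: mmoment.
  rewrite -ge0_integralZl//.
  - by apply/measurable_EFinP; apply: measurable_funTS; exact: mmoment.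
  - by move=> z _; rewrite lee_fin.
have s2 : 0 < Num.sqrt 2 :> R by rewrite sqrtr_gt0.
(* The constant comes from t^(-1/2) = sqrt 2 / sqrt(2t), where 1/sqrt(2t) is the Jacobian. *)
have int_eq : (\int[mu]_(t in `]0%R, +oo[) (t `^ (k%:R + 2^-1 - 1) * expR (- t))%:E =
   (Num.sqrt 2)%:E * \int[mu]_t (f (Num.sqrt (2 * t)) * ((Num.sqrt (2 * t))^-1)%:E))%E.
  rewrite -ge0_integralZl//; last 2 first.
  - apply: emeasurable_funM.
      exact: (measurableT_comp mf (@measurable_sqrt2 R)).
    by apply/measurable_EFinP; exact: measurable_inv_sqrt2.
  - by move=> t _; rewrite mule_ge0// lee_fin invr_ge0 sqrtr_ge0.
  rewrite [LHS]integral_mkcond; apply: eq_integral => t _.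
  rewrite patchE mem_setE in_itv/= andbT; case: ltP => t0; last first.
    by rewrite [Num.sqrt (2 * t)]ler0_sqrtr ?invr0 ?mule0// mulr_ge0_le0.
  rewrite /f /gauss -!EFinM; congr EFin.
  have t2 : 0 <= 2 * t by rewrite mulr_ge0// ltW.
  rewrite -mul2n exprM sqr_sqrtr// exprMn [2 * t / 2]mulrAC mulfV// mul1r.
  rewrite sqrtrM// [_ + 2^-1 - 1](_ : _ = k%:R - 2^-1); last by lra.
  rewrite powRD; last by rewrite (gt_eqF t0) implybT.
  rewrite powR_mulrn ?ltW// powRN powR12_sqrt ?ltW//.
  have st : 0 < Num.sqrt t by rewrite sqrtr_gt0.
  rewrite exprVn; have p0 : (2 ^+ k : R) != 0 by rewrite expf_neq0.
  move: (2 ^+ k) p0 (t ^+ k) (expR (- t)) (Num.sqrt t) st (Num.sqrt 2) s2.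
  by move=> p p0 tk e s s0 r r0; field; rewrite p0 !gt_eqF.
rewrite /Gamma /Rintegral int_eq (ge0_integral_sqrt mf f0) fE -EFinM/=.
rewrite sqrtrM// exprVn.
have p0 : (2 ^+ k : R) != 0 by rewrite expf_neq0.
have ss : Num.sqrt 2 * Num.sqrt 2 = 2 :> R by rewrite -expr2 sqr_sqrtr.
transitivity ((2 ^+ k)^-1 * ((normal_moment k.*2)%:R *
    (Num.sqrt 2 * Num.sqrt 2 * Num.sqrt pi / 2)) : R).
  by rewrite !mulrA [Num.sqrt 2 * _]mulrC -!mulrA [Num.sqrt 2 * _]mulrCA.
rewrite ss; move: (2 ^+ k) p0 (normal_moment _)%:R (Num.sqrt pi) => p p0 m c.
by field.
Qed.

End gaussian_moments.

(** * Densities on tuples *)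

Section tuple_signed_sqrt.
Variable R : realType.
Local Notation mu := (@lebesgue_measure R).
Local Open Scope ereal_scope.

Definition signed_sqrt n (b : n.-tuple bool) (t : n.-tuple R) : n.-tuple R :=
  [tuple ((-1) ^+ tnth b i * Num.sqrt (2 * tnth t i))%R | i < n].

(* Vanishes as soon as some coordinate is <= 0, since 0^-1 = 0. *)
Definition sqrt_jacobian n (t : n.-tuple R) : R :=
  (\prod_(i < n) (Num.sqrt (2 * tnth t i))^-1)%R.

Lemma measurable_signed_sqrt n (b : n.-tuple bool) :
  measurable_fun setT (signed_sqrt b).
Proof.
apply/measurable_fun_tnthP => i.
rewrite (_ : _ \o _ = (fun t : n.-tuple R =>
    ((-1) ^+ tnth b i * Num.sqrt (2 * tnth t i))%R)); last first.
  by apply/funext => t; rewrite /= tnth_mktuple.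
apply: measurable_funM => //.
exact: (measurableT_comp (@measurable_sqrt2 R) (measurable_tnth i)).
Qed.

Lemma measurable_sqrt_jacobian n : measurable_fun setT (@sqrt_jacobian n).
Proof.
apply: measurable_prod => i _.
exact: (measurableT_comp (@measurable_inv_sqrt2 R) (measurable_tnth i)).
Qed.

Lemma sqrt_jacobian_ge0 n t : (0 <= @sqrt_jacobian n t)%R.
Proof. by apply: prodr_ge0 => i _; rewrite invr_ge0 sqrtr_ge0. Qed.

Lemma ge0_integral_lebesgue_tupleS n (F : n.+1.-tuple R -> \bar R) :
  measurable_fun setT F -> (forall t, 0 <= F t) ->
  \int[lebesgue_tuple R n.+1]_t F t =
  \int[mu]_s \int[lebesgue_tuple R n]_u F (tcons (s, u)).
Proof.
move=> mF F0.
transitivity (\int[mu \x lebesgue_tuple R n]_p F (tcons p)).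
  exact: (@ge0_integral_pushforward _ _ _ _ R (@tcons R n) (@measurable_tcons R n)
    (mu \x lebesgue_tuple R n) setT F measurableT mF (fun y _ => F0 y)).
rewrite fubini_tonelli1//.
exact: measurableT_comp mF (@measurable_tcons R n).
Qed.

(** Induction by Tonelli: for a fixed first coordinate s the induction hypothesis unfolds the tail,
    and for each sign pattern b of the tail the one-dimensional formula is applied to the resulting
    function [G b] of s. *)
Lemma ge0_integral_tuple_signed_sqrt n (F : n.-tuple R -> \bar R) :
  measurable_fun setT F -> (forall t, 0 <= F t) ->
  \int[lebesgue_tuple R n]_t F t =
  \sum_(b : n.-tuple bool) \int[lebesgue_tuple R n]_t
    (F (signed_sqrt b t) * (sqrt_jacobian t)%:E).
Proof.
elim: n F => [|n IH] F mF F0.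
  rewrite (big_pred1 [tuple]) => [|b]; last by apply/esym/eqP; exact: tuple0.
  apply: eq_integral => t _; rewrite /sqrt_jacobian big_ord0 mule1.
  by congr F; rewrite [LHS]tuple0 [RHS]tuple0.
pose H b p := F (tcons (p.1, signed_sqrt b p.2)) * (@sqrt_jacobian n p.2)%:E.
have mH b : measurable_fun setT (H b).
  apply: emeasurable_funM.
    apply: (measurableT_comp mF); apply: (measurableT_comp (@measurable_tcons R n)).
    apply/measurable_fun_pairP; split => /=; first exact: measurable_fst.
    exact: (measurableT_comp (measurable_signed_sqrt b) measurable_snd).
  apply/measurable_EFinP.
  exact: (measurableT_comp (@measurable_sqrt_jacobian n) measurable_snd).
have H0 b p : 0 <= H b p by rewrite mule_ge0 ?lee_fin ?sqrt_jacobian_ge0.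
pose G b s := \int[lebesgue_tuple R n]_u H b (s, u).
have mG b : measurable_fun setT (G b).
  exact: (@measurable_fun_fubini_tonelli_F _ _ _ _ _ (lebesgue_tuple R n) _ (mH b)).
have G0 b s : 0 <= G b s by apply: integral_ge0.
rewrite ge0_integral_lebesgue_tupleS//.
transitivity (\int[mu]_s \sum_(b : n.-tuple bool) G b s).
  apply: eq_integral => s _; apply: IH => //.
  exact: (measurableT_comp (measurableT_comp mF (@measurable_tcons R n))
    (measurable_pair1 s)).
rewrite ge0_integral_sum//.
transitivity (\sum_(b : n.-tuple bool) \sum_(c : bool)
    \int[lebesgue_tuple R n.+1]_t
      (F (signed_sqrt [tuple of c :: b] t) * (sqrt_jacobian t)%:E)); last first.
  by rewrite big_tuple_cons exchange_big.
apply: eq_bigr => b _.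
rewrite (ge0_integral_signed_sqrt (mG b) (G0 b)); apply: eq_bigr => c _.
rewrite ge0_integral_lebesgue_tupleS; last 2 first.
- apply: emeasurable_funM.
    exact: (measurableT_comp mF (measurable_signed_sqrt _)).
  by apply/measurable_EFinP; exact: measurable_sqrt_jacobian.
- by move=> t; rewrite mule_ge0 ?lee_fin ?sqrt_jacobian_ge0.
have mHs s : measurable_fun setT (fun u => H b (s, u)).
  exact: (measurableT_comp (mH b) (measurable_pair1 s)).
apply: eq_integral => s _; rewrite -ge0_integralZr//.
apply: eq_integral => u _; rewrite /H/= -muleA -EFinM.
congr (F _ * _%:E).
  apply: eq_from_tnth => i; rewrite /tcons [RHS]tnth_mktuple.
  case: (unliftP ord0 i) => [j ->|->]; last by rewrite !tnth0.
  by rewrite !tnthS tnth_mktuple.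
rewrite mulrC /sqrt_jacobian big_ord_recl /tcons tnth0; congr (_ * _)%R.
by apply: eq_bigr => i _; rewrite tnthS.
Qed.

End tuple_signed_sqrt.

(** * Summation of the series defining ghat *)

Section ghat_density.
Variables (R : realType) (A : finType) (theta : edge A -> R).
Local Notation K := {ffun edge A -> nat}.
Local Notation Q := (wmatrix theta).
Implicit Types (k : K) (t z : A -> R).

Lemma normal_moment_double_gt0 m : (0 < normal_moment m.*2)%N.
Proof. by elim: m => // m IH; rewrite doubleS /= muln_gt0 IH. Qed.

(** The moment cancels against the value of Gamma, and n survives only as an exponent of sqrt(2s).
    This makes the series of [ghat] an exponential series restricted to currents. *)
Lemma moment_gamma_pdf (n : nat) (s : R) : ~~ odd n -> 0 < s ->
  (normal_moment n)%:R * gamma_pdf (n%:R / 2 + 2^-1) s =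
  Num.sqrt (2 * s) ^+ n * ((Num.sqrt s)^-1 * expR (- s) / Num.sqrt pi).
Proof.
move=> /even_halfK <- s0; move: n./2 => m.
have -> : m.*2%:R / 2 = m%:R :> R by rewrite -mul2n natrM mulrAC mulfV// mul1r.
rewrite /gamma_pdf Gamma_half.
have -> : s `^ (m%:R + 2^-1 - 1) = s ^+ m / Num.sqrt s.
  rewrite [_ + 2^-1 - 1](_ : _ = m%:R - 2^-1); last by lra.
  rewrite powRD; last by rewrite (gt_eqF s0) implybT.
  by rewrite powR_mulrn ?ltW// powRN powR12_sqrt ?ltW.
rewrite -mul2n exprM sqr_sqrtr ?mulr_ge0 ?ltW// exprMn mul2n.
have M0 : (normal_moment m.*2)%:R != 0 :> R.
  by rewrite pnatr_eq0 -lt0n normal_moment_double_gt0.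
have p0 : (2 ^+ m : R) != 0 by rewrite expf_neq0.
have st : Num.sqrt s != 0 by rewrite sqrtr_eq0 -ltNge.
have sp : Num.sqrt pi != 0 :> R by rewrite sqrtr_eq0 -ltNge pi_gt0.
move: (2 ^+ m) (normal_moment _)%:R (s ^+ m) (Num.sqrt s) (Num.sqrt pi) (expR _) p0 M0 st sp.
by move=> p M r s1 s2 e p0 M0 st sp; field; rewrite p0 M0 st sp.
Qed.

Definition sqrt2 t : A -> R := fun x => Num.sqrt (2 * t x).

Definition ghat_factor t : R :=
  expR (- (2^-1 * total_loop_measure theta)) *
  \prod_x ((Num.sqrt (t x))^-1 * expR (- t x) / Num.sqrt pi).

Definition edge_term z (e : edge A) : R := theta e / 2 * edge_monomial z e.

Lemma monomial_edge_term z k :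
  monomial (edge_term z) k =
  edge_weight theta k * \prod_e edge_monomial z e ^+ k e.
Proof.
rewrite -big_split/=; apply: eq_bigr => e _.
by rewrite /edge_term exprMn mulrAC.
Qed.

Lemma ghat_termE t k : orthant R A t -> currents R A k ->
  ghat_term theta t k = ghat_factor t * monomial (edge_term (sqrt2 t)) k.
Proof.
move=> t0 /currentsE kC.
rewrite /ghat_term current_measureE /wick -!mulrA; congr (_ * _).
rewrite monomial_edge_term [RHS]mulrCA; congr (_ * _).
rewrite prod_edge_monomial -!big_split/=; apply: eq_bigr => x _.
by rewrite addn0 [RHS]mulrC; exact: moment_gamma_pdf.
Qed.

Definition even_box M : {fset K} :=
  [fset k in box (edge A) M | [forall x, ~~ odd (kdeg k x)]]%fset.

(** Averaging over signs replaces the parity constraint, after which each inner sum runs over a full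
    box and factorizes over the edges. *)
Lemma sum_even_box M z :
  \sum_(k <- even_box M) monomial (edge_term z) k =
  2^-1 ^+ #|A| * \sum_(b : {ffun A -> bool}) \sum_(k <- box (edge A) M)
    monomial (edge_term (flip_signs b z)) k.
Proof.
rewrite exchange_big/= mulr_sumr /even_box big_fset/= big_mkcond/=.
apply: eq_bigr => k _.
under [in RHS]eq_bigr do rewrite monomial_edge_term.
rewrite -mulr_sumr parity_projection.
case: ifP => _; last by rewrite mul0r !mulr0.
rewrite monomial_edge_term [RHS]mulrCA; congr (_ * _).
by rewrite mulrA -exprMn mulVf// expr1n mul1r.
Qed.

Lemma bigcup_even_box : \bigcup_M [set` even_box M] = currents R A.
Proof.
apply/seteqP; split => [k [M _ /=]|k kC].
  by rewrite !inE/= => /andP[_ /forallP kC]; apply/currentsE.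
exists (ksize k).+1 => //=; rewrite !inE/= in_box; apply/andP; split.
  apply/forallP => e; rewrite ltnS /ksize (bigD1 e)//=; exact: leq_addr.
by apply/forallP/currentsE.
Qed.

Lemma even_box_nd i j : (i <= j)%N -> (even_box i `<=` even_box j)%fset.
Proof.
move=> ij; apply/fsubsetP => k; rewrite !inE/= !in_box => /andP[/forallP ki ->].
by rewrite andbT; apply/forallP => e; exact: leq_trans ij.
Qed.

Let even_box_current M k : k \in even_box M -> currents R A k.
Proof. by move=> kM; rewrite -bigcup_even_box; exists M. Qed.

Lemma ghat_series t : orthant R A t ->
  summable (currents R A) (fun k => (ghat_term theta t k)%:E) /\
  ghat theta t = ghat_factor t * (2^-1 ^+ #|A| *
    \sum_(b : {ffun A -> bool}) expR (\sum_e edge_term (flip_signs b (sqrt2 t)) e)).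
Proof.
move=> t0.
(* The bound drops the parity constraint: in absolute value the full box is dominated by a product
   of exponentials, uniformly in M. *)
have bnd M : \sum_(k <- even_box M) `|ghat_term theta t k| <=
    `|ghat_factor t| * expR (\sum_e `|edge_term (sqrt2 t) e|).
  rewrite (eq_big_seq (fun k => `|ghat_factor t| * `|monomial (edge_term (sqrt2 t)) k|)).
    rewrite -mulr_sumr ler_wpM2l//; apply: le_trans (sum_box_monomial_le M _).
    rewrite /even_box big_fset/= big_mkcond/=; apply: ler_sum => k _.
    by case: ifP.
  by move=> k /even_box_current kC; rewrite ghat_termE// normrM.
have [sm cv] := signed_sum_exhaustion even_box_nd bigcup_even_box bnd.
split=> //; apply: (cvg_unique _ cv) => //.
have -> : (fun M => \sum_(k <- even_box M) ghat_term theta t k) =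
    (fun M => ghat_factor t * (2^-1 ^+ #|A| *
      \sum_(b : {ffun A -> bool}) \sum_(k <- box (edge A) M)
    monomial (edge_term (flip_signs b (sqrt2 t))) k)).
  apply/funext => M; rewrite -sum_even_box mulr_sumr; apply: eq_big_seq => k.
  by move=> /even_box_current kC; rewrite ghat_termE.
apply: cvgMr; apply: cvgMr; apply: cvg_big => [|b _]; first exact: add_continuous.
exact: cvg_sum_box_monomial.
Qed.

End ghat_density.

(** * Comparison of ghat with the normal density *)

Section mvnormal_green.
Variables (R : realType) (A : finType) (theta : edge A -> R).
Hypothesis theta_integrable : integrable_weight theta.
Local Notation Q := (wmatrix theta).
Implicit Types (t z : A -> R).

Lemma quadratic_form_wmatrix z (v := \row_i z (enum_val i) : 'rV[R]_#|A|) :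
  (v *m (1%:M - Q) *m v^T) 0 0 =
  \sum_x z x ^+ 2 - 2 * \sum_e edge_term theta z e.
Proof.
rewrite mulmxBr mulmxBl mulmx1 [in LHS]mxE; congr (_ + _).
  rewrite mxE (reindex enum_rank)/=; last first.
    by apply: onW_bij; exact: enum_rank_bij.
  by apply: eq_bigr => x _; rewrite !mxE enum_rankK.
rewrite mxE; congr (- _); rewrite quadratic_edges mulrA mulfV// mul1r.
rewrite mxE exchange_big (reindex enum_rank)/=; last first.
  by apply: onW_bij; exact: enum_rank_bij.
apply: eq_bigr => x _; rewrite !mxE enum_rankK mulr_suml.
rewrite (reindex enum_rank)/=; last by apply: onW_bij; exact: enum_rank_bij.
by apply: eq_bigr => y _; rewrite !mxE !enum_rankK mulrCA mulrA [X in X * _]mulrC -mulrA.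
Qed.

(** As G has inverse I - Q, this is the density of independent standard normals tilted by exp(z Q
    z^T / 2); the determinant in the normalization is the exponential of the total loop mass. *)
Lemma mvnormal_pdf_green z : mvnormal_pdf (green theta) z =
  expR (- (2^-1 * total_loop_measure theta)) * (Num.sqrt (2 * pi))^-1 ^+ #|A| *
  (expR (\sum_e edge_term theta z e) * \prod_x expR (- (z x ^+ 2 / 2))).
Proof.
have detE := expR_total_loop_measure theta_integrable.
have Qu : 1%:M - Q \in unitmx.
  by rewrite unitmxE unitfE -detE gt_eqF ?expR_gt0.
rewrite /mvnormal_pdf /green invmxK quadratic_form_wmatrix; congr (_ * _).
  rewrite det_inv -detE -expRN opprK.
  have -> : expR (total_loop_measure theta) =
      expR (2^-1 * total_loop_measure theta) ^+ 2.
    by rewrite expr2 -expRD; congr expR; lra.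
  have pi2 : 0 <= 2 * pi :> R by rewrite mulr_ge0// pi_ge0.
  rewrite -[X in X ^+ #|A| * _](sqr_sqrtr pi2) -exprAC -exprMn sqrtr_sqr.
  rewrite ger0_norm ?mulr_ge0 ?exprn_ge0 ?sqrtr_ge0 ?expR_ge0//.
  by rewrite invfM mulrC expRN exprVn.
rewrite -expR_sum -expRD; congr expR; rewrite sumrN -mulr_suml.
by field.
Qed.

Lemma ghat_mvnormal t : orthant R A t ->
  ghat theta t = \sum_(b : {ffun A -> bool})
    mvnormal_pdf (green theta) (flip_signs b (sqrt2 t)) *
    \prod_x (Num.sqrt (2 * t x))^-1.
Proof.
move=> t0; have [_ ->] := ghat_series theta t0.
rewrite !mulr_sumr; apply: eq_bigr => b _.
rewrite mvnormal_pdf_green /ghat_factor.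
have -> : \prod_x expR (- (flip_signs b (sqrt2 t) x ^+ 2 / 2)) =
    \prod_x expR (- t x).
  apply: eq_bigr => x _; rewrite /flip_signs exprMn -exprM mulnC exprM.
  rewrite sqrrN expr1n expr1n mul1r /sqrt2 sqr_sqrtr.
    by rewrite mulrAC mulfV// mul1r.
  by rewrite mulr_ge0// ltW// t0.
(* At each vertex 1/2 = 1/(sqrt 2 sqrt 2): one root joins sqrt pi in the normal constant, the other
   joins sqrt t in the Jacobian. *)
have E : (\prod_x ((Num.sqrt (t x))^-1 * expR (- t x) / Num.sqrt pi)) * 2^-1 ^+ #|A| =
    (Num.sqrt (2 * pi))^-1 ^+ #|A| * (\prod_x expR (- t x)) *
    \prod_x (Num.sqrt (2 * t x))^-1.
  have cstE (c : R) : c ^+ #|A| = \prod_(x : A) c by rewrite prodr_const.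
  rewrite !cstE -!big_split/=; apply: eq_bigr => x _.
  have ss : (2 : R)^-1 = (Num.sqrt 2 * Num.sqrt 2)^-1 by rewrite -expr2 sqr_sqrtr.
  rewrite !sqrtrM// [in LHS]ss !invfM.
  by rewrite !mulrA; ring.
rewrite -mulrA [X in _ * X]mulrA E.
by ring.
Qed.

End mvnormal_green.

(** * The law of the half-squares *)

Section half_square_density.
Variables (R : realType) (A : finType) (theta : edge A -> R).
Hypothesis theta_integrable : integrable_weight theta.
Local Notation n := #|A|.
Local Notation pdf := (mvnormal_pdf (green theta) \o @of_tuple R A).

Definition half_squares (m : nat) (u : m.-tuple R) : m.-tuple R :=
  [tuple tnth u i ^+ 2 / 2 | i < m].

Lemma measurable_half_squares m : measurable_fun setT (@half_squares m).
Proof.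
apply/measurable_fun_tnthP => i.
rewrite (_ : _ \o _ = (fun t : m.-tuple R => tnth t i ^+ 2 / 2)); last first.
  by apply/funext => t; rewrite /= tnth_mktuple.
apply: measurable_funM => //; apply: measurable_funX; exact: measurable_tnth.
Qed.

Let orth (u : n.-tuple R) : Prop := orthant R A (of_tuple u).

Let orthE u : orth u <-> forall i, 0 < tnth u i.
Proof.
split=> [u0 i|u0 x]; last exact: u0.
by have := u0 (enum_val i); rewrite /of_tuple enum_valK.
Qed.

Lemma sqrt_jacobian_eq0 (u : n.-tuple R) : ~ orth u -> sqrt_jacobian u = 0.
Proof.
move=> uN; have [i ui] : exists i, tnth u i <= 0.
  apply: contra_notP uN => /forallNP u0; apply/orthE => i.
  by rewrite ltNge; apply/negP; exact: u0.
by rewrite /sqrt_jacobian (bigD1 i)//= ler0_sqrtr ?invr0 ?mul0r// mulr_ge0_le0.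
Qed.

Lemma half_squares_signed_sqrt (b : n.-tuple bool) u : orth u ->
  half_squares (signed_sqrt b u) = u.
Proof.
move=> /orthE u0; apply: eq_from_tnth => i; rewrite !tnth_mktuple.
rewrite exprMn -exprM mulnC exprM sqrrN !expr1n mul1r sqr_sqrtr.
  by rewrite mulrAC mulfV// mul1r.
by rewrite mulr_ge0// ltW.
Qed.

Lemma ghat_tuple u : orth u -> ghat theta (of_tuple u) =
  \sum_(b : n.-tuple bool) pdf (signed_sqrt b u) * sqrt_jacobian u.
Proof.
move=> u0; rewrite (ghat_mvnormal theta_integrable u0).
rewrite (reindex (fun b : n.-tuple bool => [ffun x => tnth b (enum_rank x)]))/=.
  apply: eq_bigr => b _; congr (mvnormal_pdf _ _ * _).
    apply/funext => x.
    by rewrite /flip_signs /sqrt2 ffunE /of_tuple tnth_mktuple.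
  rewrite /sqrt_jacobian (reindex enum_rank)//=.
  by apply: onW_bij; exact: enum_rank_bij.
exists (fun f => [tuple f (enum_val i) | i < n]) => [b _|f _].
  by apply: eq_from_tnth => i; rewrite tnth_mktuple ffunE enum_valK.
by apply/ffunP => x; rewrite ffunE tnth_mktuple enum_rankK.
Qed.

(** The event says that Z lies in B', the preimage of B under [half_squares]. After unfolding the
    integral over B' by signs, membership of [signed_sqrt b u] in B' is membership of u in B on the
    orthant; off the orthant the Jacobian kills the integrand. *)
Lemma half_square_density (d : measure_display) (T : measurableType d)
    (P : probability T R) (Z : A -> {RV P >-> R}) :
  centered_normal Z (green theta) ->
  has_density P (fun x w => Z x w ^+ 2 / 2) (orthant R A) (ghat theta).
Proof.
move=> [mpdf pdf0 PZ].
have {}mpdf : measurable_fun setT pdf by rewrite -(preimage_setT (@of_tuple R A)).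
have {}pdf0 u : 0 <= pdf u by exact: pdf0.
pose h u := \sum_(b : n.-tuple bool) pdf (signed_sqrt b u) * sqrt_jacobian u.
have mh : measurable_fun setT h.
  apply: measurable_sum => b; apply: measurable_funM.
    exact: (measurableT_comp mpdf (measurable_signed_sqrt b)).
  exact: measurable_sqrt_jacobian.
split.
- apply: (eq_measurable_fun h) => [u|]; last exact: measurable_funTS.
  by rewrite inE => u0; rewrite /= ghat_tuple.
- move=> t t0.
  have -> : t = of_tuple (to_tuple t).
    by apply/funext => x; rewrite /of_tuple tnth_mktuple enum_rankK.
  rewrite ghat_tuple; last by move=> x; rewrite /of_tuple tnth_mktuple enum_rankK.
  by apply: sumr_ge0 => b _; rewrite mulr_ge0 ?sqrt_jacobian_ge0.
move=> B mB; pose B' := @half_squares n @^-1` B.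
have mB' : measurable B'.
  by rewrite -[X in measurable X]setTI; exact: measurable_half_squares.
have -> : (fun w => to_tuple ((fun x w => Z x w ^+ 2 / 2) ^~ w)) @^-1` B =
    (fun w => to_tuple (fun x => Z x w)) @^-1` B'.
  apply/funext => w; rewrite /B' /preimage /mkset; congr B.
  by apply: eq_from_tnth => i; rewrite !tnth_mktuple.
rewrite PZ// preimage_setT setIT integral_mkcond.
set F := (_ \_ B').
have mF : measurable_fun setT F.
  by apply/(measurable_restrictT _ _).1 => //; exact/measurable_funTS/measurable_EFinP.
have F0 u : (0 <= F u)%E by rewrite /F patchE; case: ifP => // _; rewrite lee_fin; exact: pdf0.
rewrite ge0_integral_tuple_signed_sqrt// -ge0_integral_sum//=; last 2 first.
- move=> b; apply: emeasurable_funM.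
    exact: (measurableT_comp mF (measurable_signed_sqrt b)).
  by apply/measurable_EFinP; exact: measurable_sqrt_jacobian.
- by move=> b u _; rewrite mule_ge0// lee_fin sqrt_jacobian_ge0.
rewrite [RHS]integral_mkcond; apply: eq_integral => u _.
rewrite patchE; have [u0|u0] := pselect (orth u); last first.
  rewrite big1 => [|b _]; last by rewrite sqrt_jacobian_eq0// mule0.
  by rewrite memNset// => -[].
have FE b : F (signed_sqrt b u) =
    if u \in B then (pdf (signed_sqrt b u))%:E else 0%E.
  rewrite /F patchE (_ : (signed_sqrt b u \in B') = (u \in B))//.
  by apply/idP/idP => /set_mem uB; apply/mem_set; move: uB;
    rewrite /B' /preimage/= half_squares_signed_sqrt.
under eq_bigr do rewrite FE.
have -> : (u \in B `&` @of_tuple R A @^-1` orthant R A) = (u \in B).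
  by apply/idP/idP => /set_mem uB; apply/mem_set; [case: uB|split].
case: ifP => _; last by rewrite big1// => b _; rewrite mul0e.
by rewrite ghat_tuple// -sumEFin; apply: eq_bigr => b _; rewrite EFinM.
Qed.

End half_square_density.

Theorem theorem4 (R : realType) (A : finType) (theta : edge A -> R)
    (theta_integrable : integrable_weight theta) :
  (forall t : A -> R, orthant R A t ->
     summable (currents R A) (fun k => (ghat_term theta t k)%:E)) /\
  (forall (d : measure_display) (T : measurableType d) (P : probability T R)
          (Z : A -> {RV P >-> R}),
     centered_normal Z (green theta) ->
     has_density P (fun x w => Z x w ^+ 2 / 2) (orthant R A) (ghat theta)).
Proof.
split=> [t t0|d T P Z Znormal]; first by have [] := ghat_series theta t0.
exact: half_square_density.
Qed.
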